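(* Let $n\ge2$, $m\ge1$, and for $0\le j\le m$ put $$\kappa_{n,<j}=\prod_{p=0}^{j-1}(q\,\omega_{n-1+pn}\,\omega_{n+pn})^{-1},\qquad \kappa_{n,>j}=\prod_{p=j+1}^{m-1}(q\,\omega_{n-1+pn}\,\omega_{n+pn})^{-1}.$$ There is an algebra homomorphism $\mathcal L_q:U_q(\mathfrak{so}_{2n})\to Cl_q(nm)$ satisfying $$E_n\mapsto\sum_{j=0}^{m-1}\psi^\dagger_{n-1+jn}\psi^\dagger_{n+jn}\,\kappa_{n,<j},\qquad F_n\mapsto\sum_{j=0}^{m-1}\kappa_{n,>j}^{-1}\,\psi_{n+jn}\psi_{n-1+jn},\qquad K_n\mapsto\kappa_{n,<m},$$ and $\mathcal L_q(X)=\lambda_q(X)$ for every $X$ in the subalgebra $U_q(\mathfrak{sl}_n)\subset U_q(\mathfrak{so}_{2n})$ generated by $E_i,F_i,K_i^{\pm1}$, $1\le i\le n-1$.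
   Context: The base field is $\mathbb C(q)$, $q$ an indeterminate. $Cl_q(p)$ is the unital associative algebra generated by $\psi_a,\psi_a^\dagger,\omega_a^{\pm1}$ ($1\le a\le p$) with relations: the $\omega_a$ commute; $\omega_a\psi_b\omega_a^{-1}=q^{\delta_{ab}}\psi_b$; $\omega_a\psi_b^\dagger\omega_a^{-1}=q^{-\delta_{ab}}\psi_b^\dagger$; $\psi_a\psi_b+\psi_b\psi_a=0=\psi_a^\dagger\psi_b^\dagger+\psi_b^\dagger\psi_a^\dagger$; $\psi_a\psi_b^\dagger+\psi_b^\dagger\psi_a=0$ for $a\ne b$; $\psi_a\psi_a^\dagger=\frac{q\omega_a-q^{-1}\omega_a^{-1}}{q-q^{-1}}$, $\psi_a^\dagger\psi_a=-\frac{\omega_a-\omega_a^{-1}}{q-q^{-1}}$. $U_q(\mathfrak{so}_{2n})$ has generators $E_i,F_i,K_i^{\pm1}$ ($1\le i\le n$) and relations: the $K_i$ commute, $K_iE_jK_i^{-1}=q^{a_{ij}}E_j$, $K_iF_jK_i^{-1}=q^{-a_{ij}}F_j$, $[E_i,F_j]=\delta_{ij}\frac{K_i-K_i^{-1}}{q-q^{-1}}$, and the quantum Serre relations, where $(a_{ij})$ is the Cartan matrix of type $D_n$ with simple roots $\alpha_i=e_i-e_{i+1}$ ($i<n$), $\alpha_n=e_{n-1}+e_n$. The algebra map $\lambda_q:U_q(\mathfrak{sl}_n)\to Cl_q(nm)$ is, for $1\le i\le n-1$ and $k_{i,p}=\omega_{i+pn}^{-1}\omega_{i+1+pn}$: $E_i\mapsto\sum_{j=0}^{m-1}\psi^\dagger_{i+jn}\psi_{i+1+jn}\prod_{p<j}k_{i,p}$,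 $F_i\mapsto\sum_{j=0}^{m-1}\big(\prod_{p>j}k_{i,p}^{-1}\big)\psi^\dagger_{i+1+jn}\psi_{i+jn}$, $K_i\mapsto\prod_{p=0}^{m-1}k_{i,p}$ (products over $p\in\{0,\dots,m-1\}$). *)

(* Defs.v *)
From HB Require Import structures.
From mathcomp Require Import all_boot all_order all_algebra.
From mathcomp Require Import boolp reals.
From mathcomp Require Import complex.
From mathcomp Require Import finmap monalg.

Set Implicit Arguments.
Unset Strict Implicit.
Unset Printing Implicit Defensive.

Import GRing.Theory.

Local Open Scope ring_scope.
Local Open Scope quotient_scope.

(** * The base field *)

Definition Cq (R : realType) : fieldType := {fraction {poly R[i]}}.

Definition qvar (R : realType) : Cq R := tofrac ('X : {poly R[i]}).

(** * Unital associative algebras given by generators and relations *)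

(* The free unital associative [K]-algebra on [X] is the monoid algebra of the
   free monoid [{fmonom X}]. *)
Notation "{ 'free' K [ X ] }" := {malg K[{fmonom X}]}
  (at level 0, K at level 2, X at level 2, format "{ 'free'  K [ X ] }")
  : type_scope.

(* The locks below only prevent the unfolding of the quotient structure. *)
HB.lock Definition fgen (K : fieldType) (X : choiceType) (x : X) : {free K[X]} :=
  << fmu x >>.

Notation free_rel K X := ({free K[X]} -> {free K[X]} -> Prop).

Lemma fmonomE (K : fieldType) (X : choiceType) (u : {fmonom X}) :
  << u >> = \prod_(x <- (u : seq X)) fgen K x.
Proof.
rewrite -{1}(fmK u); elim: (u : seq X) => [|x t IH].
  by rewrite big_nil -fmoneE.
rewrite big_cons -IH fgen.unlock malgM_def fgmulUU mulr1; congr (<< _ *g _ >>).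
by apply/eqP; rewrite fmP fmM fmU.
Qed.

Section Presentation.
Variables (K : fieldType) (X : choiceType).
Implicit Types rel : free_rel K X.

(* [rel l r] reads "l = r is one of the defining relations"; the two-sided
   ideal is the one generated by the differences [l - r]. *)
Inductive ideal_gen rel : {free K[X]} -> Prop :=
| ideal_gen0 : ideal_gen rel 0
| ideal_genD x y : ideal_gen rel x -> ideal_gen rel y -> ideal_gen rel (x + y)
| ideal_gen_rel a b l r : rel l r -> ideal_gen rel (a * (l - r) * b).

Definition pres_ideal rel : {pred {free K[X]}} := fun x => `[< ideal_gen rel x >].

Lemma ideal_genN rel x : ideal_gen rel x -> ideal_gen rel (- x).
Proof.
elim=> [|{}x y _ IHx _ IHy|a b l r lr].
- by rewrite oppr0; exact: ideal_gen0.
- by rewrite opprD; exact: ideal_genD.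
- by rewrite -!mulNr; exact: ideal_gen_rel.
Qed.

Lemma ideal_genMl rel a x : ideal_gen rel x -> ideal_gen rel (a * x).
Proof.
elim=> [|{}x y _ IHx _ IHy|a' b l r lr].
- by rewrite mulr0; exact: ideal_gen0.
- by rewrite mulrDr; exact: ideal_genD.
- by rewrite !mulrA; exact: ideal_gen_rel.
Qed.

Lemma ideal_genMr rel a x : ideal_gen rel x -> ideal_gen rel (x * a).
Proof.
elim=> [|{}x y _ IHx _ IHy|a' b l r lr].
- by rewrite mul0r; exact: ideal_gen0.
- by rewrite mulrDl; exact: ideal_genD.
- by rewrite -mulrA; exact: ideal_gen_rel.
Qed.

Lemma pres_ideal_zmod_closed rel : zmod_closed (pres_ideal rel).
Proof.
split=> [|x y /asboolP Ix /asboolP Iy]; apply/asboolP; first exact: ideal_gen0.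
by apply: ideal_genD => //; apply: ideal_genN.
Qed.

HB.instance Definition _ rel :=
  GRing.isZmodClosed.Build {free K[X]} (pres_ideal rel)
    (pres_ideal_zmod_closed rel).

Definition presAlg rel := Quotient.quot (pres_ideal rel).

HB.instance Definition _ rel := GRing.Zmodule.on (presAlg rel).

End Presentation.

HB.lock Definition pres_pi (K : fieldType) (X : choiceType) (rel : free_rel K X) :
  {free K[X]} -> presAlg rel := \pi_(presAlg rel).

HB.lock Definition pgen (K : fieldType) (X : choiceType) (rel : free_rel K X)
  (x : X) : presAlg rel := pres_pi rel (fgen K x).

HB.lock Definition pres_one (K : fieldType) (X : choiceType) (rel : free_rel K X) :
  presAlg rel := pres_pi rel 1.

HB.lock Definition pres_mul (K : fieldType) (X : choiceType) (rel : free_rel K X)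
  (x y : presAlg rel) : presAlg rel := pres_pi rel (repr x * repr y).

HB.lock Definition pres_scale (K : fieldType) (X : choiceType)
  (rel : free_rel K X) (c : K) (x : presAlg rel) : presAlg rel :=
  pres_pi rel (c *: repr x).

Section PresentedAlgebra.
Variables (K : fieldType) (X : choiceType) (rel : free_rel K X).
Local Notation A := (presAlg rel).
Local Notation pres_pi := (pres_pi rel).
Local Notation pres_one := (pres_one rel).
Local Notation pres_mul := (@pres_mul K X rel).
Local Notation pres_scale := (@pres_scale K X rel).
Local Notation pgen := (@pgen K X rel).

Lemma pres_eqP x y : pres_pi x = pres_pi y <-> ideal_gen rel (x - y).
Proof.
split=> [/eqP|I]; last apply/eqP; rewrite pres_pi.unlock -Quotient.idealrBE;
  by [move/asboolP | apply/asboolP].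
Qed.

Lemma pres_rel l r : rel l r -> pres_pi l = pres_pi r.
Proof.
move=> lr; apply/pres_eqP; rewrite -[_ - _]mul1r -[_ * _]mulr1.
exact: ideal_gen_rel.
Qed.

Lemma pres_reprK (x : A) : pres_pi (repr x) = x.
Proof. by rewrite pres_pi.unlock reprK. Qed.

Lemma pres_piB : {morph pres_pi : x y / x - y}.
Proof. by move=> x y; rewrite pres_pi.unlock !piE. Qed.
HB.instance Definition _ :=
  GRing.isZmodMorphism.Build {free K[X]} A pres_pi pres_piB.

Lemma ideal_gen_repr x : ideal_gen rel (repr (pres_pi x) - x).
Proof. by apply/pres_eqP; rewrite pres_reprK. Qed.

Lemma pres_mulE x y : pres_mul (pres_pi x) (pres_pi y) = pres_pi (x * y).
Proof.
rewrite pres_mul.unlock; apply/pres_eqP; set x' := repr _; set y' := repr _.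
have -> : x' * y' - x * y = (x' - x) * y' + x * (y' - y).
  by rewrite mulrBl mulrBr addrA subrK.
apply: ideal_genD; first by apply: ideal_genMr; apply: ideal_gen_repr.
by apply: ideal_genMl; apply: ideal_gen_repr.
Qed.

Lemma pres_scaleE c x : pres_scale c (pres_pi x) = pres_pi (c *: x).
Proof.
rewrite pres_scale.unlock; apply/pres_eqP; rewrite -scalerBr -mul_malgC.
by apply: ideal_genMl; apply: ideal_gen_repr.
Qed.

Lemma presP (P : A -> Prop) : (forall x, P (pres_pi x)) -> forall x, P x.
Proof. by move=> Ppi x; rewrite -(pres_reprK x). Qed.

Fact pres_mulA : associative pres_mul.
Proof.
elim/presP=> x; elim/presP=> y; elim/presP=> z.
by rewrite !pres_mulE mulrA.
Qed.
Fact pres_mul1 : left_id pres_one pres_mul.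
Proof. by elim/presP=> x; rewrite pres_one.unlock pres_mulE mul1r. Qed.
Fact pres_mulr1 : right_id pres_one pres_mul.
Proof. by elim/presP=> x; rewrite pres_one.unlock pres_mulE mulr1. Qed.
Fact pres_mulDl : left_distributive pres_mul +%R.
Proof.
elim/presP=> x; elim/presP=> y; elim/presP=> z.
by rewrite -raddfD !pres_mulE mulrDl raddfD.
Qed.
Fact pres_mulDr : right_distributive pres_mul +%R.
Proof.
elim/presP=> x; elim/presP=> y; elim/presP=> z.
by rewrite -raddfD !pres_mulE mulrDr raddfD.
Qed.

(* The quotient is not assumed to be nontrivial, hence the absence of an
   [algType] instance, which would require 1 != 0. *)
HB.instance Definition _ := GRing.Zmodule_isPzRing.Build A
  pres_mulA pres_mul1 pres_mulr1 pres_mulDl pres_mulDr.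

Fact pres_scaleA c d x : pres_scale c (pres_scale d x) = pres_scale (c * d) x.
Proof. by elim/presP: x => x; rewrite !pres_scaleE scalerA. Qed.
Fact pres_scale1 : left_id 1 pres_scale.
Proof. by elim/presP=> x; rewrite pres_scaleE scale1r. Qed.
Fact pres_scaleDr : right_distributive pres_scale +%R.
Proof.
move=> c; elim/presP=> x; elim/presP=> y.
by rewrite -raddfD !pres_scaleE scalerDr raddfD.
Qed.
Fact pres_scaleDl x : {morph pres_scale^~ x : c d / c + d}.
Proof. by move=> c d; elim/presP: x => x; rewrite !pres_scaleE scalerDl raddfD. Qed.

HB.instance Definition _ := GRing.Zmodule_isLmodule.Build K A
  pres_scaleA pres_scale1 pres_scaleDr pres_scaleDl.

Lemma pres_piM : {morph pres_pi : x y / x * y}.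
Proof. by move=> x y; exact: (esym (pres_mulE x y)). Qed.
Lemma pres_pi1 : pres_pi 1 = 1.
Proof. by rewrite -[RHS]/pres_one pres_one.unlock. Qed.
HB.instance Definition _ :=
  GRing.isMonoidMorphism.Build {free K[X]} A pres_pi (pres_pi1, pres_piM).

Lemma pgenE x : pgen x = pres_pi (fgen K x).
Proof. by rewrite pgen.unlock. Qed.

Lemma pres_piZ : scalable pres_pi.
Proof. by move=> c x; exact: (esym (pres_scaleE c x)). Qed.
HB.instance Definition _ :=
  GRing.isScalable.Build K {free K[X]} A *:%R pres_pi pres_piZ.

Lemma pres_scalerAl (c : K) (x y : A) : c *: (x * y) = (c *: x) * y.
Proof.
elim/presP: x => x; elim/presP: y => y.
by rewrite -pres_piM -!pres_piZ -pres_piM scalerAl.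
Qed.

Lemma malg_scalerAr (c : K) (x y : {free K[X]}) : c *: (x * y) = x * (c *: y).
Proof.
have cx : c *: x = x * c%:MP; last first.
  rewrite (scalerAl c x y) cx -(mul_malgC c y).
  exact: (esym (mulrA x c%:MP y)).
rewrite malgM_def fgmulgU [LHS]monalgE (big_fset_incl _ (msuppZ_le c x)) /=; last first.
  by move=> k _ /mcoeff_outdom ->; rewrite monalgU0.
by apply: eq_bigr => k _; rewrite mulm1 mcoeffZ mulrC.
Qed.

Lemma pres_scalerAr (c : K) (x y : A) : c *: (x * y) = x * (c *: y).
Proof.
elim/presP: x => x; elim/presP: y => y.
by rewrite -pres_piM -!pres_piZ -pres_piM malg_scalerAr.
Qed.

Inductive subalg_gen (S : A -> Prop) : A -> Prop :=
| subalg_gen_in x : S x -> subalg_gen S x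
| subalg_gen1 : subalg_gen S 1
| subalg_genD x y : subalg_gen S x -> subalg_gen S y -> subalg_gen S (x + y)
| subalg_genM x y : subalg_gen S x -> subalg_gen S y -> subalg_gen S (x * y)
| subalg_genZ c x : subalg_gen S x -> subalg_gen S (c *: x).

Lemma subalg_gen_pgen x : subalg_gen (fun y => exists g, y = pgen g) x.
Proof.
elim/presP: x => x; rewrite (monalgE x) raddf_sum /=.
apply: big_ind => [|y z|u _]; last 1 first.
- have -> : << x@_u *g u >> = x@_u *: << u >> :> {free K[X]}.
    by rewrite -mul_malgC malgM_def fgmulUU mulr1 mul1m.
  rewrite pres_piZ fmonomE; apply: subalg_genZ; rewrite rmorph_prod /=.
  elim: (u : seq X) => [|y t IH]; first by rewrite big_nil; apply: subalg_gen1.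
  rewrite big_cons -pgenE; apply: subalg_genM => //.
  by apply: subalg_gen_in; exists y.
- by rewrite -(scale0r (1 : A)); apply: subalg_genZ; apply: subalg_gen1.
- exact: subalg_genD.
Qed.

Lemma pres_hom_ext (B : pzRingType) (s : K -> B -> B) (f g : {rmorphism A -> B}) :
  scalable_for s f -> scalable_for s g ->
  (forall x, f (pgen x) = g (pgen x)) -> f =1 g.
Proof.
move=> fZ gZ fg x.
elim: (subalg_gen_pgen x) => [{}x [y ->]||{}x y _ IHx _ IHy|{}x y _ IHx _ IHy|c {}x _ IHx].
- exact: fg.
- by rewrite !rmorph1.
- by rewrite !rmorphD /= IHx IHy.
- by rewrite !rmorphM /= IHx IHy.
- by rewrite fZ gZ IHx.
Qed.

End PresentedAlgebra.

(* The homomorphism between presented algebras determined by the images [g] of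
   the generators, when these satisfy the defining relations. *)
Section Lift.
Variables (K : fieldType) (X Y : choiceType).
Variables (relX : free_rel K X) (relY : free_rel K Y).
Local Notation A := (presAlg relX).
Local Notation B := (presAlg relY).

Definition free_lift (g : X -> B) (x : {free K[X]}) : B :=
  \sum_(u <- msupp x) x@_u *: \prod_(i <- (u : seq X)) g i.

Variable g : X -> B.
Local Notation mon u := (\prod_(i <- (u%M : {fmonom X}) : seq X) g i).

Lemma free_liftEw (d : {fset {fmonom X}}) x : (msupp x `<=` d)%fset ->
  free_lift g x = \sum_(u <- d) x@_u *: mon u.
Proof.
move=> le; rewrite [LHS](big_fset_incl _ le) => //= u _ /mcoeff_outdom ->.
by rewrite scale0r.
Qed.

Lemma free_liftU c u : free_lift g << c *g u >> = c *: mon u.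
Proof. by rewrite (free_liftEw msuppU_le) big_seq_fset1 mcoeffUU. Qed.

Lemma free_lift_gen x : free_lift g (fgen K x) = g x.
Proof. by rewrite fgen.unlock free_liftU scale1r fmU big_seq1. Qed.

Lemma free_liftB : {morph free_lift g : x y / x - y}.
Proof.
move=> x y; pose d := (msupp x `|` msupp y)%fset.
rewrite (free_liftEw (msuppB_le x y)) (free_liftEw (fsubsetUl _ (msupp y))).
rewrite (free_liftEw (fsubsetUr (msupp x) _)) -sumrB; apply: eq_bigr => u _.
by rewrite mcoeffB scalerBl.
Qed.
HB.instance Definition _ :=
  GRing.isZmodMorphism.Build {free K[X]} B (free_lift g) free_liftB.

Lemma free_liftM : monoid_morphism (free_lift g).
Proof.
split=> [|x y]; first by rewrite free_liftU scale1r fm1 big_nil.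
rewrite malgME raddf_sum mulr_suml /=; apply: eq_bigr => u _.
rewrite raddf_sum mulr_sumr /=; apply: eq_bigr => v _.
rewrite free_liftU fmM big_cat /=.
by rewrite -pres_scalerAl -pres_scalerAr scalerA.
Qed.
HB.instance Definition _ :=
  GRing.isMonoidMorphism.Build {free K[X]} B (free_lift g) free_liftM.

Lemma free_liftZ : scalable (free_lift g).
Proof.
move=> c x; rewrite (free_liftEw (msuppZ_le c x)) scaler_sumr.
by apply: eq_bigr => u _; rewrite mcoeffZ scalerA.
Qed.
HB.instance Definition _ :=
  GRing.isScalable.Build K {free K[X]} B *:%R (free_lift g) free_liftZ.

Hypothesis grel : forall l r, relX l r -> free_lift g l = free_lift g r.

Definition pres_lift of (forall l r, relX l r -> free_lift g l = free_lift g r) :=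
  fun x : A => free_lift g (repr x).

Local Notation f := (pres_lift grel).

Lemma pres_liftE x : f (pres_pi relX x) = free_lift g x.
Proof.
apply/eqP; rewrite -subr_eq0 -raddfB /=; apply/eqP.
elim: (ideal_gen_repr relX x) => [|{}x y _ IHx _ IHy|a b l r lr].
- exact: raddf0.
- by rewrite raddfD /= IHx IHy addr0.
- by rewrite !rmorphM rmorphB /= (grel lr) subrr mulr0 mul0r.
Qed.

Lemma pres_lift_gen x : f (pgen relX x) = g x.
Proof. by rewrite pgenE pres_liftE free_lift_gen. Qed.

Lemma pres_liftB : {morph f : x y / x - y}.
Proof.
by elim/presP=> x; elim/presP=> y; rewrite -raddfB /= !pres_liftE raddfB.
Qed.
HB.instance Definition _ := GRing.isZmodMorphism.Build A B f pres_liftB.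

Lemma pres_liftM : monoid_morphism f.
Proof.
split=> [|x y]; first by rewrite -(pres_pi1 relX) pres_liftE rmorph1.
elim/presP: x => x; elim/presP: y => y.
by rewrite -pres_piM !pres_liftE rmorphM.
Qed.
HB.instance Definition _ := GRing.isMonoidMorphism.Build A B f pres_liftM.

Lemma pres_liftZ : scalable f.
Proof. by move=> c; elim/presP=> x; rewrite -pres_piZ !pres_liftE free_liftZ. Qed.
HB.instance Definition _ := GRing.isScalable.Build K A B *:%R f pres_liftZ.

End Lift.

(* [same_val g x y]: substituting [g] in [x] gives the class of [y]. The lemmas
   below prove it by recursion on the expression of [x] and [y]. *)
Section SameVal.
Variables (K : fieldType) (X Y : choiceType) (relY : free_rel K Y).
Variable g : X -> presAlg relY.

Definition same_val (x : {free K[X]}) (y : {free K[Y]}) :=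
  free_lift g x = pres_pi relY y.

Lemma same_valM x x' y y' : same_val x y -> same_val x' y' ->
  same_val (x * x') (y * y').
Proof. by rewrite /same_val rmorphM /= pres_piM => -> ->. Qed.
Lemma same_valD x x' y y' : same_val x y -> same_val x' y' ->
  same_val (x + x') (y + y').
Proof. by rewrite /same_val !raddfD /= => -> ->. Qed.
Lemma same_valN x y : same_val x y -> same_val (- x) (- y).
Proof. by rewrite /same_val !raddfN /= => ->. Qed.
Lemma same_valZ c x y : same_val x y -> same_val (c *: x) (c *: y).
Proof. by rewrite /same_val free_liftZ pres_piZ => ->. Qed.
Lemma same_valX x y k : same_val x y -> same_val (x ^+ k) (y ^+ k).
Proof. by rewrite /same_val !rmorphXn /= => ->. Qed.
Lemma same_val0 : same_val 0 0.
Proof. by rewrite /same_val !raddf0. Qed.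
Lemma same_val1 : same_val 1 1.
Proof. by rewrite /same_val !rmorph1. Qed.
Lemma same_val_gen x y : g x = pgen relY y -> same_val (fgen K x) (fgen K y).
Proof. by rewrite /same_val free_lift_gen pgenE. Qed.

Lemma pres_relE l r l' r' : relY l' r' -> same_val l l' -> same_val r r' ->
  free_lift g l = free_lift g r.
Proof. by move=> lr' -> ->; apply: pres_rel. Qed.

End SameVal.

Ltac ev_free := repeat lazymatch goal with
  | |- same_val _ (_ * _) _ => apply: same_valM
  | |- same_val _ (_ + _) _ => apply: same_valD
  | |- same_val _ (- _) _ => apply: same_valN
  | |- same_val _ (_ *: _) _ => apply: same_valZ
  | |- same_val _ (_ ^+ _) _ => apply: same_valX
  | |- same_val _ 0 _ => apply: same_val0
  | |- same_val _ 1 _ => apply: same_val1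
  | |- same_val _ (fgen _ _) _ => apply: same_val_gen
  end.

(** * The quantum Clifford algebra [Cl_q(p)] *)

(* [ClOmV a] stands for the inverse of [ClOm a]. *)
Inductive cl_gen (p : nat) :=
  ClPsi of 'I_p | ClPsid of 'I_p | ClOm of 'I_p | ClOmV of 'I_p.

Section ClGenChoice.
Variable p : nat.
Definition cl_gen_enc (x : cl_gen p) : 'I_4 * 'I_p :=
  match x with
  | ClPsi a => (inord 0, a) | ClPsid a => (inord 1, a)
  | ClOm a => (inord 2, a) | ClOmV a => (inord 3, a)
  end.
Definition cl_gen_dec (x : 'I_4 * 'I_p) : cl_gen p :=
  match val x.1 with
  | 0 => ClPsi x.2 | 1 => ClPsid x.2 | 2 => ClOm x.2 | _ => ClOmV x.2
  end%N.
Lemma cl_gen_encK : cancel cl_gen_enc cl_gen_dec.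
Proof. by case=> a; rewrite /cl_gen_dec /= inordK. Qed.
HB.instance Definition _ := Choice.copy (cl_gen p) (can_type cl_gen_encK).
End ClGenChoice.

Section Clifford.
Variables (K : fieldType) (q : K) (p : nat).

Section Rel.
Local Notation psi a := (fgen K (ClPsi a)).
Local Notation psid a := (fgen K (ClPsid a)).
Local Notation om a := (fgen K (ClOm a)).
Local Notation omV a := (fgen K (ClOmV a)).
Local Notation FA := {free K[cl_gen p]}.

Inductive cl_rel : FA -> FA -> Prop :=
| cl_om_omV a : cl_rel (om a * omV a) 1
| cl_omV_om a : cl_rel (omV a * om a) 1
| cl_om_om a b : cl_rel (om a * om b) (om b * om a)
| cl_om_psi a b : cl_rel (om a * psi b * omV a) (q ^+ (a == b) *: psi b)
| cl_om_psid a b : cl_rel (om a * psid b * omV a) (q ^- (a == b) *: psid b)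
| cl_psi_psi a b : cl_rel (psi a * psi b + psi b * psi a) 0
| cl_psid_psid a b : cl_rel (psid a * psid b + psid b * psid a) 0
| cl_psi_psid_neq a b of a != b : cl_rel (psi a * psid b + psid b * psi a) 0
| cl_psi_psid a : cl_rel (psi a * psid a)
    ((q - q^-1)^-1 *: (q *: om a - q^-1 *: omV a))
| cl_psid_psi a : cl_rel (psid a * psi a)
    (- ((q - q^-1)^-1 *: (om a - omV a))).
End Rel.

Definition Cl := presAlg cl_rel.
HB.instance Definition _ := GRing.PzRing.on Cl.
HB.instance Definition _ := GRing.Lmodule.on Cl.

Definition psi a : Cl := pgen cl_rel (ClPsi a).
Definition psid a : Cl := pgen cl_rel (ClPsid a).
Definition om a : Cl := pgen cl_rel (ClOm a).
Definition omV a : Cl := pgen cl_rel (ClOmV a).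

Lemma om_omV a : om a * omV a = 1.
Proof. by have := pres_rel (cl_om_omV a); rewrite pres_piM pres_pi1 -!pgenE. Qed.

Lemma omV_om a : omV a * om a = 1.
Proof. by have := pres_rel (cl_omV_om a); rewrite pres_piM pres_pi1 -!pgenE. Qed.

Lemma om_comm a b : om a * om b = om b * om a.
Proof.
rewrite /om !pgenE; apply: etrans (esym (pres_piM _ _ _)) _.
exact: etrans (pres_rel (cl_om_om a b)) (pres_piM _ _ _).
Qed.

Lemma omV_comm_om a b : omV a * om b = om b * omV a.
Proof.
by rewrite -[LHS]mulr1 -(om_omV a) !mulrA -(mulrA (omV a)) (om_comm b)
  mulrA omV_om mul1r.
Qed.

Lemma omV_comm a b : omV a * omV b = omV b * omV a.
Proof.
by rewrite -[LHS]mulr1 -(om_omV a) !mulrA -(mulrA (omV a)) omV_comm_om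
  mulrA omV_om mul1r.
Qed.

End Clifford.

Arguments psi {K q p}.
Arguments psid {K q p}.
Arguments om {K q p}.
Arguments omV {K q p}.

(** * Drinfeld-Jimbo algebras *)

(* [UKV i] stands for the inverse of [UK i]. *)
Inductive uq_gen (r : nat) := UE of 'I_r | UF of 'I_r | UK of 'I_r | UKV of 'I_r.

Section UqGenChoice.
Variable r : nat.
Definition uq_gen_enc (x : uq_gen r) : 'I_4 * 'I_r :=
  match x with
  | UE i => (inord 0, i) | UF i => (inord 1, i)
  | UK i => (inord 2, i) | UKV i => (inord 3, i)
  end.
Definition uq_gen_dec (x : 'I_4 * 'I_r) : uq_gen r :=
  match val x.1 with
  | 0 => UE x.2 | 1 => UF x.2 | 2 => UK x.2 | _ => UKV x.2
  end%N.
Lemma uq_gen_encK : cancel uq_gen_enc uq_gen_dec.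
Proof. by case=> a; rewrite /uq_gen_dec /= inordK. Qed.
HB.instance Definition _ := Choice.copy (uq_gen r) (can_type uq_gen_encK).
End UqGenChoice.

(* Only for simply laced Cartan matrices [c]: the off-diagonal entries are
   0 or -1, and the Serre relations below cover exactly these two cases. *)
Section QuantumGroup.
Variables (K : fieldType) (q : K) (r : nat) (c : 'M[int]_r).

Section Rel.
Local Notation E i := (fgen K (UE i)).
Local Notation F i := (fgen K (UF i)).
Local Notation k i := (fgen K (UK i)).
Local Notation kV i := (fgen K (UKV i)).
Local Notation FA := {free K[uq_gen r]}.

Inductive uq_rel : FA -> FA -> Prop :=
| uq_K_KV i : uq_rel (k i * kV i) 1
| uq_KV_K i : uq_rel (kV i * k i) 1
| uq_K_K i j : uq_rel (k i * k j) (k j * k i)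
| uq_K_E i j : uq_rel (k i * E j * kV i) (q ^ c i j *: E j)
| uq_K_F i j : uq_rel (k i * F j * kV i) (q ^ (- c i j) *: F j)
| uq_E_F i j : uq_rel (E i * F j - F j * E i)
    (((i == j)%:R / (q - q^-1)) *: (k i - kV i))
| uq_serre_E0 i j of i != j & c i j = 0 :
    uq_rel (E i * E j - E j * E i) 0
| uq_serre_F0 i j of i != j & c i j = 0 :
    uq_rel (F i * F j - F j * F i) 0
| uq_serre_E1 i j of i != j & c i j = -1 :
    uq_rel (E i ^+ 2 * E j - (q + q^-1) *: (E i * E j * E i) + E j * E i ^+ 2) 0
| uq_serre_F1 i j of i != j & c i j = -1 :
    uq_rel (F i ^+ 2 * F j - (q + q^-1) *: (F i * F j * F i) + F j * F i ^+ 2) 0.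
End Rel.

Definition Uq := presAlg uq_rel.
HB.instance Definition _ := GRing.PzRing.on Uq.
HB.instance Definition _ := GRing.Lmodule.on Uq.

Definition uE i : Uq := pgen uq_rel (UE i).
Definition uF i : Uq := pgen uq_rel (UF i).
Definition uK i : Uq := pgen uq_rel (UK i).
Definition uKV i : Uq := pgen uq_rel (UKV i).

Lemma uK_uKV i : uK i * uKV i = 1.
Proof.
rewrite /uK /uKV !pgenE -(pres_pi1 uq_rel) -(pres_rel (uq_K_KV i)).
exact: esym (pres_piM _ _ _).
Qed.

Lemma uKV_uK i : uKV i * uK i = 1.
Proof.
rewrite /uK /uKV !pgenE -(pres_pi1 uq_rel) -(pres_rel (uq_KV_K i)).
exact: esym (pres_piM _ _ _).
Qed.

End QuantumGroup.

Arguments uE {K q r c}.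
Arguments uF {K q r c}.
Arguments uK {K q r c}.
Arguments uKV {K q r c}.

(** * Root data *)

(* Indices are shifted by one: [eps n k] is e_{k+1}, the index [i : 'I_n.-1] of
   sl_n (resp. [i : 'I_n] of so_2n) is the node i+1. *)
Definition eps (n k : nat) : 'rV[int]_n := \row_(j < n) (j == k :> nat)%:Z.

Definition rootA n (i : 'I_n.-1) : 'rV[int]_n := eps n i - eps n i.+1.

Definition rootD n (i : 'I_n) : 'rV[int]_n :=
  if (i.+1 < n)%N then eps n i - eps n i.+1 else eps n n.-2 + eps n n.-1.

(* The simple roots all have squared length 2, so the Cartan integers are their
   scalar products. *)
Definition cartan n r (root : 'I_r -> 'rV[int]_n) : 'M[int]_r :=
  \matrix_(i, j) (root i *m (root j)^T) 0 0.

Definition Uq_sl (K : fieldType) (q : K) n := Uq q (cartan (@rootA n)).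
Definition Uq_so (K : fieldType) (q : K) n := Uq q (cartan (@rootD n)).

Section Inclusion.
Variables (K : fieldType) (q : K) (n : nat).

HB.instance Definition _ := GRing.PzRing.on (Uq_sl q n).
HB.instance Definition _ := GRing.Lmodule.on (Uq_sl q n).
HB.instance Definition _ := GRing.PzRing.on (Uq_so q n).
HB.instance Definition _ := GRing.Lmodule.on (Uq_so q n).

Definition nodeA (i : 'I_n.-1) : 'I_n := widen_ord (leq_pred n) i.

Lemma cartan_nodeA i j :
  cartan (@rootD n) (nodeA i) (nodeA j) = cartan (@rootA n) i j.
Proof.
have lt_n (i' : 'I_n.-1) : (i'.+1 < n)%N by case: i' => i' /=; case: (n).
by rewrite !mxE /rootD /= !lt_n.
Qed.

Lemma nodeA_inj : injective nodeA.
Proof. by move=> i j /(congr1 val) /= /val_inj. Qed.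

Definition sl_incl_gen (x : uq_gen n.-1) : Uq_so q n :=
  match x with
  | UE i => uE (nodeA i) | UF i => uF (nodeA i)
  | UK i => uK (nodeA i) | UKV i => uKV (nodeA i)
  end.

Lemma sl_incl_rel l r : uq_rel q (cartan (@rootA n)) l r ->
  free_lift sl_incl_gen l = free_lift sl_incl_gen r.
Proof.
have S := @pres_relE _ _ _ (uq_rel q (cartan (@rootD n))).
case=> [i|i|i j|i j|i j|i j|i j ij c0|i j ij c0|i j ij c1|i j ij c1].
- by apply: (S _ _ _ _ _ _ (@uq_K_KV K q _ _ (nodeA i))); ev_free.
- by apply: (S _ _ _ _ _ _ (@uq_KV_K K q _ _ (nodeA i))); ev_free.
- by apply: (S _ _ _ _ _ _ (@uq_K_K K q _ _ (nodeA i) (nodeA j))); ev_free.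
- rewrite -cartan_nodeA.
  by apply: (S _ _ _ _ _ _ (@uq_K_E K q _ _ (nodeA i) (nodeA j))); ev_free.
- rewrite -cartan_nodeA.
  by apply: (S _ _ _ _ _ _ (@uq_K_F K q _ _ (nodeA i) (nodeA j))); ev_free.
- rewrite -(inj_eq nodeA_inj).
  by apply: (S _ _ _ _ _ _ (@uq_E_F K q _ _ (nodeA i) (nodeA j))); ev_free.
- rewrite -cartan_nodeA in c0; rewrite -(inj_eq nodeA_inj) in ij.
  by apply: (S _ _ _ _ _ _ (@uq_serre_E0 K q _ _ _ _ ij c0)); ev_free.
- rewrite -cartan_nodeA in c0; rewrite -(inj_eq nodeA_inj) in ij.
  by apply: (S _ _ _ _ _ _ (@uq_serre_F0 K q _ _ _ _ ij c0)); ev_free.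
- rewrite -cartan_nodeA in c1; rewrite -(inj_eq nodeA_inj) in ij.
  by apply: (S _ _ _ _ _ _ (@uq_serre_E1 K q _ _ _ _ ij c1)); ev_free.
- rewrite -cartan_nodeA in c1; rewrite -(inj_eq nodeA_inj) in ij.
  by apply: (S _ _ _ _ _ _ (@uq_serre_F1 K q _ _ _ _ ij c1)); ev_free.
Qed.

(* The canonical map U_q(sl_n) -> U_q(so_2n), given by E_i |-> E_i, F_i |-> F_i,
   K_i |-> K_i for 1 <= i <= n-1. *)
Definition sl_incl : Uq_sl q n -> Uq_so q n := pres_lift sl_incl_rel.

HB.instance Definition _ :=
  GRing.RMorphism.copy sl_incl (pres_lift sl_incl_rel).

Lemma sl_inclZ : scalable sl_incl.
Proof. exact: pres_liftZ. Qed.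

Definition sl_gens (x : Uq_so q n) : Prop :=
  exists i, [\/ x = uE (nodeA i), x = uF (nodeA i), x = uK (nodeA i)
               | x = uKV (nodeA i)].

(* The image of [sl_incl] is the subalgebra generated by E_i, F_i, K_i^{+-1},
   1 <= i <= n-1. *)
Lemma sl_incl_image y : subalg_gen sl_gens y <-> exists x, sl_incl x = y.
Proof.
split=> [|[x <-]].
  elim=> [z [i [->|->|->|->]]||y1 y2 _ [x1 <-] _ [x2 <-]
         |y1 y2 _ [x1 <-] _ [x2 <-]|c y1 _ [x1 <-]].
  - by exists (uE i); rewrite /sl_incl pres_lift_gen.
  - by exists (uF i); rewrite /sl_incl pres_lift_gen.
  - by exists (uK i); rewrite /sl_incl pres_lift_gen.
  - by exists (uKV i); rewrite /sl_incl pres_lift_gen.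
  - by exists 1; rewrite rmorph1.
  - by exists (x1 + x2); rewrite rmorphD.
  - by exists (x1 * x2); rewrite rmorphM.
  - by exists (c *: x1); rewrite sl_inclZ.
elim: (subalg_gen_pgen x) => [{}x [g ->]||x1 x2 _ IH1 _ IH2|x1 x2 _ IH1 _ IH2|c x1 _ IH].
- apply: subalg_gen_in; rewrite /sl_incl pres_lift_gen.
  by case: g => i; exists i; [apply: Or41|apply: Or42|apply: Or43|apply: Or44].
- by rewrite rmorph1; apply: subalg_gen1.
- by rewrite rmorphD; apply: subalg_genD.
- by rewrite rmorphM; apply: subalg_genM.
- by rewrite sl_inclZ; apply: subalg_genZ.
Qed.

End Inclusion.

(** * The map lambda_q and the elements kappa *)

Section Formulas.
Variables (K : fieldType) (q : K) (n m : nat).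
Local Notation C := (Cl q (n * m)).

(* Indices are 0-based: the 1-based position of [site i j] is (i+1) + jn. *)
Lemma site_subproof (i : 'I_n) (j : 'I_m) : (i + j * n < n * m)%N.
Proof.
apply: (@leq_trans (j.+1 * n)); first by rewrite mulSn ltn_add2r.
by rewrite (mulnC n) leq_mul2r ltn_ord orbT.
Qed.
Definition site (i : 'I_n) (j : 'I_m) : 'I_(n * m) := Ordinal (site_subproof i j).

(* The node i of sl_n (0-based) involves the coordinates [nodeA i] and
   [nodeA_next i], of values i and i+1. *)
Lemma nodeA_next_subproof (i : 'I_n.-1) : (i.+1 < n)%N.
Proof. by case: i => i /=; case: (n). Qed.
Definition nodeA_next (i : 'I_n.-1) : 'I_n := Ordinal (nodeA_next_subproof i).

(* k_{i,p} and its inverse. *)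
Definition kfac (i : 'I_n.-1) (p : 'I_m) : C :=
  omV (site (nodeA i) p) * om (site (nodeA_next i) p).
Definition kfacV (i : 'I_n.-1) (p : 'I_m) : C :=
  omV (site (nodeA_next i) p) * om (site (nodeA i) p).

Lemma omV_om_swap a b : (omV a * om b) * (omV b * om a) = 1 :> C.
Proof.
by rewrite mulrA -(mulrA (omV a)) om_omV mulr1 omV_om.
Qed.

Lemma kfacK i p : kfac i p * kfacV i p = 1.
Proof. exact: omV_om_swap. Qed.

Lemma kfacVK i p : kfacV i p * kfac i p = 1.
Proof. exact: omV_om_swap. Qed.

(* The defining properties of lambda_q; as a homomorphism of algebras it is
   determined by them, see [is_lambda_unique]. *)
Definition is_lambda (f : Uq_sl q n -> C) : Prop :=
  forall i : 'I_n.-1,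
  [/\ f (uE i) = \sum_(j < m) psid (site (nodeA i) j)
                   * psi (site (nodeA_next i) j)
                   * \prod_(p < m | (p < j)%N) kfac i p,
      f (uF i) = \sum_(j < m) (\prod_(p < m | (j < p)%N) kfacV i p)
                   * psid (site (nodeA_next i) j) * psi (site (nodeA i) j)
    & f (uK i) = \prod_(p < m) kfac i p].

Lemma is_lambda_unique (f g : {rmorphism Uq_sl q n -> C}) :
  scalable f -> scalable g -> is_lambda f -> is_lambda g -> f =1 g.
Proof.
move=> fZ gZ fl gl; apply: (pres_hom_ext fZ gZ) => -[] i; have [fE fF fK] := fl i;
  have [gE gF gK] := gl i.
- exact: etrans fE (esym gE).
- exact: etrans fF (esym gF).
- exact: etrans fK (esym gK).
have KV : uK i * uKV i = 1 :> Uq_sl q n by exact: uK_uKV.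
have VK : uKV i * uK i = 1 :> Uq_sl q n by exact: uKV_uK.
rewrite -/(uKV i); transitivity (f (uKV i) * (g (uK i) * g (uKV i))).
  by rewrite -rmorphM KV rmorph1 mulr1.
by rewrite gK -fK mulrA -rmorphM VK rmorph1 mul1r.
Qed.

Hypothesis n_gt1 : (1 < n)%N.

(* The coordinates n-1 and n in 1-based numbering. *)
Definition ord_penult : 'I_n := @Ordinal n n.-2 (leq_ltn_trans (leq_pred n.-1)
  (eq_leq (prednK (ltnW n_gt1)))).
Definition ord_last : 'I_n := @Ordinal n n.-1 (eq_leq (prednK (ltnW n_gt1))).

(* (q omega_{n-1+pn} omega_{n+pn})^{-1} and its inverse. *)
Definition kappa_fac (p : 'I_m) : C :=
  q^-1 *: (omV (site ord_penult p) * omV (site ord_last p)).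
Definition kappa_facV (p : 'I_m) : C :=
  q *: (om (site ord_penult p) * om (site ord_last p)).

(* [kappa_gtV j] is the inverse of [kappa_gt j], see [kappa_gtK] and
   [kappa_gtVK]; the factors commute, so the order of the products is
   immaterial. *)
Definition kappa_lt (j : nat) : C := \prod_(p < m | (p < j)%N) kappa_fac p.
Definition kappa_gt (j : nat) : C := \prod_(p < m | (j < p)%N) kappa_fac p.
Definition kappa_gtV (j : nat) : C := \prod_(p < m | (j < p)%N) kappa_facV p.

Section KappaInverse.
Hypothesis q_neq0 : q != 0.

Lemma comm_om_omV a b : GRing.comm (om a : C) (omV b).
Proof. exact: esym (omV_comm_om q b a). Qed.

Lemma kappa_fac_comm p p' : kappa_fac p * kappa_facV p' = kappa_facV p' * kappa_fac p.
Proof.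
rewrite /kappa_fac /kappa_facV -!pres_scalerAl -!pres_scalerAr !scalerA mulrC.
congr (_ *: _); apply: GRing.commrM; apply: GRing.commr_sym;
  by apply: GRing.commrM; apply: comm_om_omV.
Qed.

Lemma kappa_facK p : kappa_fac p * kappa_facV p = 1.
Proof.
rewrite /kappa_fac /kappa_facV -pres_scalerAl -pres_scalerAr scalerA mulVf //.
by rewrite scale1r omV_comm mulrA -(mulrA (omV _)) omV_om mulr1 omV_om.
Qed.

Lemma kappa_gtK j : kappa_gt j * kappa_gtV j = 1.
Proof.
rewrite /kappa_gt /kappa_gtV -GRing.prodrM_comm => [|p p' _ _].
  by apply: big1 => p _; apply: kappa_facK.
exact: kappa_fac_comm.
Qed.

Lemma kappa_gtVK j : kappa_gtV j * kappa_gt j = 1.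
Proof.
rewrite -(kappa_gtK j); apply: GRing.commr_prod => p _; apply: GRing.commr_sym.
by apply: GRing.commr_prod => p' _; apply: kappa_fac_comm.
Qed.

End KappaInverse.

End Formulas.

(* Main.v *)
Require Import Defs.
From HB Require Import structures.
From mathcomp Require Import all_boot all_order all_algebra.
From mathcomp Require Import boolp reals.
From mathcomp Require Import complex.
From mathcomp Require Import finmap monalg.
From mathcomp Require Import ring zify.

Set Implicit Arguments.
Unset Strict Implicit.
Unset Printing Implicit Defensive.

Import GRing.Theory.

Local Open Scope ring_scope.

(* Write -e_k for the k-th coordinate with the opposite sign, and let phi_u be
   psi_k if u = e_k and psi_k^dagger if u = -e_k; likewise w_u is omega_k or
   (q omega_k)^{-1}. Each node of D_n gives a pair (a, b) of signed coordinates
   whose sum is minus the simple root. For m = 1 the map sends E to phi_a phi_b,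
   F to phi_{-b} phi_{-a} and K to q w_a w_b. Two such products commute when
   their coordinates are disjoint up to sign, and their product vanishes when
   they share a coordinate; hence the shape of the diagram plays no role, only
   the fact that the off-diagonal Cartan integers, which are scalar products of
   the pairs, are 0 or -1. For general m, there are m mutually commuting copies
   of this representation, indexed by the blocks of n consecutive coordinates,
   and the formulas are those of the iterated coproduct. *)

(** * Scalars and commutation up to a scalar in presented algebras *)

Section PresentedAlgebraTheory.
Variables (K : fieldType) (X : choiceType) (rel : free_rel K X).
Local Notation B := (presAlg rel).
Implicit Types (x y z : B) (c d : K).

Lemma pscaleAl c x y : (c *: x) * y = c *: (x * y).
Proof. by rewrite pres_scalerAl. Qed.

Lemma pscaleAr c x y : x * (c *: y) = c *: (x * y).
Proof. by rewrite pres_scalerAr. Qed.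

Definition qcomm c x y := x * y = c *: (y * x).

Lemma qcomm1 x y : qcomm 1 x y <-> GRing.comm x y.
Proof. by rewrite /qcomm scale1r. Qed.

Lemma qcommMl c d x y z : qcomm c x z -> qcomm d y z -> qcomm (c * d) (x * y) z.
Proof.
by rewrite /qcomm => xz yz; rewrite -mulrA yz pscaleAr mulrA xz
  pscaleAl scalerA -mulrA mulrC.
Qed.

Lemma qcommMr c d x y z : qcomm c x y -> qcomm d x z -> qcomm (c * d) x (y * z).
Proof.
by rewrite /qcomm => xy xz; rewrite mulrA xy pscaleAl -mulrA xz
  pscaleAr scalerA mulrA.
Qed.

Lemma qcommDr c x y z : qcomm c x y -> qcomm c x z -> qcomm c x (y + z).
Proof. by rewrite /qcomm mulrDr mulrDl scalerDr => -> ->. Qed.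

Lemma qcomm_sym c x y : c != 0 -> qcomm c x y -> qcomm c^-1 y x.
Proof. by rewrite /qcomm => c0 ->; rewrite scalerA mulVf // scale1r. Qed.

Lemma qcommZl c d x y : qcomm c x y -> qcomm c (d *: x) y.
Proof. by rewrite /qcomm pscaleAl pscaleAr => ->; rewrite !scalerA mulrC. Qed.

Lemma qcommV c x xV y : c != 0 -> x * xV = 1 -> xV * x = 1 ->
  qcomm c x y -> qcomm c^-1 xV y.
Proof.
rewrite /qcomm => c0 xxV xVx xy; apply: (scalerI c0).
rewrite scalerA mulfV // scale1r -[RHS]mul1r -xVx -!mulrA (mulrA x) xy.
by rewrite pscaleAl pscaleAr -mulrA xxV mulr1.
Qed.

Lemma commZl c x y : GRing.comm x y -> GRing.comm (c *: x) y.
Proof. by move=> /qcomm1 xy; apply/qcomm1/qcommZl. Qed.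

End PresentedAlgebraTheory.

(** * The quantum Serre expression and its behaviour on sums *)

Section Serre.
Variables (K : fieldType) (X : choiceType) (rel : free_rel K X) (q : K).
Hypothesis q0 : q != 0.
Local Notation B := (presAlg rel).

(* The polarization of the quantum Serre expression in its quadratic variable. *)
Definition serre (x z y : B) : B :=
  x * z * y - (q + q^-1) *: (x * y * z) + y * x * z.

Let addr6 (a b c d e f : B) : a + b - (c + d) + (e + f) = a - c + e + (b - d + f).
Proof. by rewrite opprD (addrACA a) [RHS]addrACA. Qed.

Lemma serreDl x x' z y : serre (x + x') z y = serre x z y + serre x' z y.
Proof. by rewrite /serre !(mulrDl, mulrDr) scalerDr addr6. Qed.

Lemma serreDm x z z' y : serre x (z + z') y = serre x z y + serre x z' y.
Proof. by rewrite /serre !(mulrDl, mulrDr) scalerDr addr6. Qed.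

Lemma serreDr x z y y' : serre x z (y + y') = serre x z y + serre x z y'.
Proof. by rewrite /serre !(mulrDl, mulrDr) scalerDr addr6. Qed.

(** The shape taken by a sum of two [serre] expressions once every monomial is a multiple of one of
    two ordered monomials [u], [v]; it remains to check one scalar identity for each. *)
Let lincomb (u v : B) (k1 k2 k3 k4 k5 k6 k7 k8 : K) :
  k1 - k2 + k3 - k4 = 0 -> k5 - k6 + k7 - k8 = 0 ->
  k1 *: u - k2 *: u + k5 *: v - k6 *: v +
    (k3 *: u - k4 *: u + k7 *: v - k8 *: v) = 0.
Proof.
move=> k0 l0; rewrite -(addrA (k1 *: u - _)) -(addrA (k3 *: u - _)) addrACA.
by rewrite -!scalerBl -!scalerDl !addrA k0 l0 !scale0r addr0.
Qed.

(** Moving [a] to the right end leaves the monomials [x * y * a] and [y * x * a], with coefficients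
    q^-1 - (q + q^-1) + q and 1 - (q + q^-1) q + q^2, both zero. *)
Lemma serre_qcomm2 (x a y : B) : qcomm (q ^+ 2) a x -> qcomm q^-1 a y ->
  serre x a y + serre a x y = 0.
Proof.
rewrite /qcomm /serre => ax ay.
have -> : x * a * y = q^-1 *: (x * y * a) by rewrite -mulrA ay pscaleAr mulrA.
have -> : a * x * y = q *: (x * y * a).
  rewrite ax pscaleAl -mulrA ay pscaleAr scalerA mulrA; congr (_ *: _).
  by rewrite expr2 mulfK.
have -> : a * y * x = q *: (y * x * a).
  rewrite ay pscaleAl -mulrA ax pscaleAr scalerA mulrA; congr (_ *: _).
  by rewrite expr2 mulKf.
have -> : y * a * x = q ^+ 2 *: (y * x * a) by rewrite -mulrA ax pscaleAr mulrA.
set u := x * y * a; set v := y * x * a.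
have := @lincomb u v q^-1 (q + q^-1) q 0 1 0 (q ^+ 2) ((q + q^-1) * q).
rewrite !scale0r !subr0 scale1r -scalerA.
by rewrite -[_ + _ *: v - _]addrA [_ *: v - _]addrC addrA; apply; field.
Qed.

(** Same cancellation, this time moving [x] to the left end. *)
Lemma serre_qcomm1 (x a b : B) : qcomm (q ^+ 2) a x -> qcomm q^-1 b x ->
  serre x a b + serre a x b = 0.
Proof.
rewrite /qcomm /serre => ax bx.
have -> : b * x * a = q^-1 *: (x * b * a) by rewrite bx pscaleAl.
have -> : a * x * b = q ^+ 2 *: (x * a * b) by rewrite ax pscaleAl.
have -> : a * b * x = q *: (x * a * b).
  rewrite -mulrA bx pscaleAr mulrA ax pscaleAl scalerA; congr (_ *: _).
  by rewrite expr2 mulKf.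
have -> : b * a * x = q *: (x * b * a).
  rewrite -mulrA ax pscaleAr mulrA bx pscaleAl scalerA; congr (_ *: _).
  by rewrite expr2 mulfK.
set u := x * a * b; set v := x * b * a.
have := @lincomb u v 1 0 (q ^+ 2) ((q + q^-1) * q) q^-1 (q + q^-1) q 0.
rewrite !scale0r !subr0 scale1r -scalerA.
by rewrite -[_ + _ *: v - _]addrA [_ *: v - _]addrC addrA; apply; field.
Qed.

(** All terms are multiples of [x * x * b], and the coefficient is t^2 - (q + q^-1) t + 1 at its
    root t = q^-1. *)
Lemma serre_qcommr (x b : B) : qcomm q^-1 b x -> serre x x b = 0.
Proof.
rewrite /qcomm /serre => bx.
rewrite bx pscaleAl -[x * b * x]mulrA bx pscaleAr !mulrA !scalerA.
by rewrite -[X in X - _]scale1r -scalerBl -scalerDl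
  [X in X *: _](_ : _ = 0) ?scale0r //; field.
Qed.

Lemma serre_qcommq (a y : B) : qcomm q^-1 a y -> serre a a y = 0.
Proof.
rewrite /qcomm /serre => ay.
rewrite -[a * a * y]mulrA ay pscaleAr pscaleAl (mulrA a) ay pscaleAl !scalerA.
by rewrite -[X in _ + X]scale1r -scalerBl -scalerDl
  [X in X *: _](_ : _ = 0) ?scale0r //; field.
Qed.

(** The Serre relation for the two summands of a coproduct. Of the eight terms of the trilinear
    expansion, two vanish by hypothesis, two by q-commutation alone, and the other four cancel in
    pairs. *)
Lemma serreD (x y a b : B) :
  qcomm (q ^+ 2) a x -> qcomm q^-1 a y -> qcomm q^-1 b x ->
  serre x x y = 0 -> serre a a b = 0 -> serre (x + a) (x + a) (y + b) = 0.
Proof.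
move=> ax ay bx xy ab.
rewrite !serreDl !serreDm !serreDr xy ab (serre_qcommr bx) (serre_qcommq ay).
by rewrite !add0r !addr0 addrACA (serre_qcomm2 ax ay) (serre_qcomm1 ax bx) addr0.
Qed.

End Serre.

(** * Commutation of sums and products *)

Lemma commDD (A : pzRingType) (a b c d : A) :
  GRing.comm a c -> GRing.comm a d -> GRing.comm b c -> GRing.comm b d ->
  GRing.comm (a + b) (c + d).
Proof.
move=> ac ad bc bd; apply: commrD; apply: commr_sym; apply: commrD;
  exact: commr_sym.
Qed.

Lemma commMM (A : pzRingType) (a b c d : A) :
  GRing.comm a c -> GRing.comm a d -> GRing.comm b c -> GRing.comm b d ->
  GRing.comm (a * b) (c * d).
Proof.
move=> ac ad bc bd; apply: commrM; apply: commr_sym; apply: commrM;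
  exact: commr_sym.
Qed.

(** Each of the three monomials releases the same factor [k * k * l]. This handles the coproduct
    summands that carry a Cartan factor from the other tensor component. *)
Lemma serreMr (K : fieldType) (X : choiceType) (rel : free_rel K X) (q : K)
    (x y k l : presAlg rel) :
  GRing.comm k x -> GRing.comm k y -> GRing.comm l x -> GRing.comm l y ->
  GRing.comm k l ->
  serre q (x * k) (x * k) (y * l) = serre q x x y * (k * k * l).
Proof.
move=> kx ky lx ly kl; rewrite /serre !mulrDl mulNr pscaleAl.
have M a b c u v w : GRing.comm u b -> GRing.comm u c -> GRing.comm v c ->
    a * u * (b * v) * (c * w) = a * b * c * (u * v * w) :> presAlg rel.
  move=> ub uc vc.
  rewrite !mulrA -(mulrA a) (ub : _ = _) !mulrA -(mulrA _ v) (vc : _ = _).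
  by rewrite !mulrA -(mulrA _ u) (uc : _ = _) !mulrA.
have k1 : k * l * k = k * k * l by rewrite -mulrA -(kl : _ = _) mulrA.
by rewrite !M // k1 -(kl : _ = _) k1.
Qed.

Lemma commutatorD (A : pzRingType) (a b c d : A) :
  GRing.comm a d -> GRing.comm b c ->
  (a + b) * (c + d) - (c + d) * (a + b) = a * c - c * a + (b * d - d * b).
Proof.
rewrite /GRing.comm => ad bc; rewrite !(mulrDl, mulrDr) ad bc.
rewrite [X in X - _]addrACA opprD [LHS]addrACA !opprD.
by rewrite (addrACA (a * c)) (addrACA (d * a)) !subrr addr0 add0r.
Qed.

(** * Families satisfying the relations of the quantum group, and their coproduct *)

Section UqFamily.
Variables (K : fieldType) (q : K) (r : nat) (c : 'M[int]_r).
Variables (Y : choiceType) (rel : free_rel K Y).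
Local Notation B := (presAlg rel).
Hypotheses (q0 : q != 0) (c_sym : forall i j, c i j = c j i).
Hypothesis c_diag : forall i, c i i = 2.

(** The defining relations read on the values of [g], with conjugation by K replaced by
    q-commutation and the Serre relations put in the trilinear form [serre], both of which pass
    easily to coproducts. *)
Record uq_family (g : uq_gen r -> B) : Prop := UqFamily {
  fam_KKV : forall i, g (UK i) * g (UKV i) = 1;
  fam_KVK : forall i, g (UKV i) * g (UK i) = 1;
  fam_KK : forall i j, GRing.comm (g (UK i)) (g (UK j));
  fam_KE : forall i j, qcomm (q ^ c i j) (g (UK i)) (g (UE j));
  fam_KF : forall i j, qcomm (q ^ (- c i j)) (g (UK i)) (g (UF j));
  fam_EF : forall i j, g (UE i) * g (UF j) - g (UF j) * g (UE i) =
    ((i == j)%:R / (q - q^-1)) *: (g (UK i) - g (UKV i));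
  fam_E0 : forall i j, i != j -> c i j = 0 -> GRing.comm (g (UE i)) (g (UE j));
  fam_F0 : forall i j, i != j -> c i j = 0 -> GRing.comm (g (UF i)) (g (UF j));
  fam_E1 : forall i j, i != j -> c i j = -1 ->
    serre q (g (UE i)) (g (UE i)) (g (UE j)) = 0;
  fam_F1 : forall i j, i != j -> c i j = -1 ->
    serre q (g (UF i)) (g (UF i)) (g (UF j)) = 0 }.

Lemma uq_family_rel g : uq_family g -> forall x y, uq_rel q c x y ->
  free_lift g x = free_lift g y.
Proof.
move=> [KKV KVK KK KE KF EF E0 F0 E1 F1] x y.
have lM : {morph free_lift g : u v / u * v} by exact: rmorphM.
have lD : {morph free_lift g : u v / u + v} by exact: raddfD.
have lN : {morph free_lift g : u / - u} by exact: raddfN.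
have l1 : free_lift g 1 = 1 by exact: rmorph1.
have l0 : free_lift g 0 = 0 by exact: raddf0.
have lE := (free_lift_gen, lM, lD, lN, free_liftZ).
case=> [i|i|i j|i j|i j|i j|i j ij cij|i j ij cij|i j ij cij|i j ij cij].
- by rewrite !lE l1 KKV.
- by rewrite !lE l1 KVK.
- rewrite [LHS]lM [RHS]lM !free_lift_gen; exact: KK.
- by rewrite !lE KE -pscaleAl -mulrA KKV mulr1.
- by rewrite !lE KF -pscaleAl -mulrA KKV mulr1.
- by rewrite !lE EF.
- by rewrite !lE l0 E0 // subrr.
- by rewrite !lE l0 F0 // subrr.
- by rewrite !expr2 !mulrA !lE l0; apply: E1.
- by rewrite !expr2 !mulrA !lE l0; apply: F1.
Qed.

Lemma comm_KV g i z : uq_family g -> GRing.comm z (g (UK i)) ->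
  GRing.comm z (g (UKV i)).
Proof.
move=> gf zK; rewrite /GRing.comm -[LHS]mul1r -(fam_KVK gf i) -!mulrA (mulrA _ z).
by rewrite -(zK : _ = _) -!mulrA (fam_KKV gf) mulr1.
Qed.

Lemma qcomm_KV g i k z : uq_family g -> k != 0 -> qcomm k (g (UK i)) z ->
  qcomm k^-1 (g (UKV i)) z.
Proof. by move=> gf k0; apply: qcommV; rewrite ?(fam_KKV gf) ?(fam_KVK gf). Qed.

(* The value at the generators of the composite of the coproduct with g (x) g'. *)
Definition coprod_gen (g g' : uq_gen r -> B) (x : uq_gen r) : B :=
  match x with
  | UE i => g (UE i) + g' (UE i) * g (UK i)
  | UF i => g' (UKV i) * g (UF i) + g' (UF i)
  | UK i => g (UK i) * g' (UK i)
  | UKV i => g (UKV i) * g' (UKV i)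
  end.

(** The mixed E-F terms commute, and the two remaining commutators, weighted by [g' (UKV i)] and
    [g (UK i)], telescope. The Serre relations follow from [serreD], since the weighted summand
    q-commutes with the plain one by the Cartan integer. *)
Lemma uq_family_coprod g g' : uq_family g -> uq_family g' ->
  (forall x y, GRing.comm (g x) (g' y)) -> uq_family (coprod_gen g g').
Proof.
move=> gf gf' gg'.
have qz k : q ^ k != 0 by rewrite expfz_neq0.
have C x y : qcomm 1 (g x) (g' y) by apply/qcomm1.
have C' x y : qcomm 1 (g' y) (g x) by apply/qcomm1/commr_sym.
have VF i j : qcomm (q ^ c i j) (g' (UKV i)) (g' (UF j)).
  by rewrite -[c i j]opprK -invr_expz; apply: qcomm_KV => //; apply: fam_KF.
have VE i j : qcomm (q ^ (- c i j)) (g' (UKV i)) (g' (UE j)).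
  by rewrite -invr_expz; apply: qcomm_KV => //; apply: fam_KE.
have KV i j : GRing.comm (g' (UKV i)) (g' (UKV j)).
  apply: comm_KV => //; apply: commr_sym; apply: comm_KV => //.
  exact: fam_KK.
have QE i j : qcomm (q ^ c i j) (g' (UE i) * g (UK i)) (g (UE j)).
  by rewrite -[q ^ _]mul1r; apply: qcommMl => //; apply: fam_KE.
have QF i j : qcomm (q ^ c i j) (g' (UKV i) * g (UF i)) (g' (UF j)).
  by rewrite -[q ^ _]mulr1; apply: qcommMl.
split=> /=.
- move=> i; rewrite mulrA -(mulrA (g _)) (esym (gg' _ _) : _ = _).
  by rewrite mulrA (fam_KKV gf) mul1r (fam_KKV gf').
- move=> i; rewrite mulrA -(mulrA (g _)) (esym (gg' _ _) : _ = _).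
  by rewrite mulrA (fam_KVK gf) mul1r (fam_KVK gf').
- move=> i j; apply: commrM; apply: commr_sym; apply: commrM.
  + exact: fam_KK gf _ _.
  + exact: gg'.
  + exact/commr_sym/gg'.
  + exact: fam_KK gf' _ _.
- move=> i j; apply: qcommDr.
  + by rewrite -[q ^ _]mulr1; apply: qcommMl => //; apply: fam_KE.
  + rewrite -[q ^ _]mulr1; apply: qcommMr; last first.
      by rewrite -[1]mul1r; apply: qcommMl => //; apply/qcomm1; apply: fam_KK.
    by rewrite -[q ^ _]mul1r; apply: qcommMl => //; apply: fam_KE.
- move=> i j; apply: qcommDr.
  + rewrite -[q ^ _]mul1r; apply: qcommMr.
      rewrite -[1]mul1r; apply: qcommMl => //; apply/qcomm1.
      by apply: comm_KV => //; apply: fam_KK.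
    by rewrite -[q ^ _]mulr1; apply: qcommMl => //; apply: fam_KF.
  + by rewrite -[q ^ _]mul1r; apply: qcommMl => //; apply: fam_KF.
- move=> i j; rewrite commutatorD; first 1 last.
  + exact: gg'.
  + apply: commr_sym; apply/qcomm1.
    (* Moving [g' (UKV j)] past [g' (UE i)] costs the first power of q, moving [g (UF j)] past
       [g (UK i)] the second; they are inverse by symmetry of [c]. *)
    have -> : 1 = q ^ (- c i j) * 1 * (1 * q ^ c i j) :> K.
      by rewrite mulr1 mul1r -invr_expz mulVf.
    apply: qcommMl; apply: qcommMr => //; first by rewrite c_sym.
    rewrite -[c i j]opprK -invr_expz; apply: qcomm_sym => //.
    exact: fam_KF.
  have -> : g (UE i) * (g' (UKV j) * g (UF j)) = g' (UKV j) * (g (UE i) * g (UF j)).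
    by rewrite mulrA (gg' _ _ : _ = _) mulrA.
  have -> : g' (UE i) * g (UK i) * g' (UF j) = g' (UE i) * g' (UF j) * g (UK i).
    by rewrite -mulrA (gg' _ _ : _ = _) mulrA.
  rewrite -(mulrA (g' (UKV j))) (mulrA (g' (UF j))) -mulrBr -mulrBl.
  rewrite (fam_EF gf) (fam_EF gf') pscaleAl pscaleAr -scalerDr.
  have [<-|_] := eqVneq i j; last by rewrite mul0r !scale0r.
  congr (_ *: _); rewrite mulrBl mulrBr -!(gg' _ _ : _ = _) addrC.
  by rewrite -addrA (addrA (- _)) addNr add0r.
- move=> i j ij cij; apply: commDD; last 1 first.
  + apply: commMM; [exact: (fam_E0 gf')|exact/commr_sym|exact: gg'|exact: fam_KK].
  + exact: (fam_E0 gf).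
  + by apply/commr_sym/qcomm1; have := QE j i; rewrite c_sym cij.
  + by apply/qcomm1; have := QE i j; rewrite cij.
- move=> i j ij cij; apply: commDD; last 1 first.
  + exact: (fam_F0 gf').
  + apply: commMM; [exact: KV|exact/commr_sym|exact: gg'|exact: (fam_F0 gf)].
  + by apply/qcomm1; have := QF i j; rewrite cij.
  + by apply/commr_sym/qcomm1; have := QF j i; rewrite c_sym cij.
- move=> i j ij cij; apply: serreD => //.
  + by have := QE i i; rewrite c_diag.
  + by have := QE i j; rewrite cij.
  + by have := QE j i; rewrite c_sym cij.
  + exact: (fam_E1 gf).
  + rewrite serreMr ?(fam_E1 gf') ?mul0r //; exact: fam_KK.
(* For F the weighted summand comes first, so the sums are swapped to match [serreD]. *)
- move=> i j ij cij; rewrite ![_ * _ + _]addrC; apply: serreD => //.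
  + by have := QF i i; rewrite c_diag.
  + by have := QF i j; rewrite cij.
  + by have := QF j i; rewrite c_sym cij.
  + exact: (fam_F1 gf').
  + rewrite -!(gg' _ _ : _ = _) serreMr ?(fam_F1 gf) ?mul0r //;
      by [apply/commr_sym | apply: KV].
Qed.

End UqFamily.

(** * The iterated coproduct of mutually commuting families *)

Section IteratedCoproduct.
Variables (K : fieldType) (q : K) (r : nat) (c : 'M[int]_r).
Variables (Y : choiceType) (rel : free_rel K Y).
Local Notation B := (presAlg rel).
Hypotheses (q0 : q != 0) (c_sym : forall i j, c i j = c j i).
Hypothesis c_diag : forall i, c i i = 2.

Definition iter_gen m (g : 'I_m -> uq_gen r -> B) (x : uq_gen r) : B :=
  match x with
  | UE i => \sum_(j < m) g j (UE i) * \prod_(p < m | (p < j)%N) g p (UK i)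
  | UF i => \sum_(j < m) (\prod_(p < m | (j < p)%N) g p (UKV i)) * g j (UF i)
  | UK i => \prod_(p < m) g p (UK i)
  | UKV i => \prod_(p < m) g p (UKV i)
  end.

(** Splitting off the last family exhibits the closed formula as one more coproduct, which allows
    induction on [m]. *)
Lemma iter_genS m (g : 'I_m.+1 -> uq_gen r -> B) :
  (forall j p x y, j != p -> GRing.comm (g j x) (g p y)) ->
  iter_gen g =1
    coprod_gen (iter_gen (fun j => g (widen_ord (leqnSn m) j))) (g ord_max).
Proof.
move=> gC [] i /=; rewrite !big_ord_recr //=.
- congr (_ + _).
    apply: eq_bigr => j _; congr (_ * _); rewrite big_mkcond big_ord_recr /=.
    by rewrite ltnNge ltnW //= mulr1 -big_mkcond.
  congr (_ * _); rewrite big_mkcond big_ord_recr /= ltnn mulr1.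
  by apply: eq_bigr => j _; rewrite ltn_ord.
- congr (_ + _); last first.
    rewrite big_pred0 ?mul1r // => p.
    by apply/negbTE; rewrite -leqNgt -ltnS ltn_ord.
  rewrite mulr_sumr; apply: eq_bigr => j _; rewrite mulrA; congr (_ * _).
  rewrite big_mkcond big_ord_recr /= ltn_ord -big_mkcond /=.
  (* The K^-1 factor of the last family stands at the end of the product and has to be moved to its
     front. *)
  apply: commr_sym; apply: commr_prod => p _; apply: gC.
  by rewrite -val_eqE /= gtn_eqF.
Qed.

Lemma uq_family_iter m (g : 'I_m -> uq_gen r -> B) :
  (forall j, uq_family q c (g j)) ->
  (forall j p x y, j != p -> GRing.comm (g j x) (g p y)) ->
  uq_family q c (iter_gen g).
Proof.
elim: m g => [|m IHm] g gf gC.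
  (* The empty family gives the counit: E and F go to 0, K and its inverse to 1. *)
  have C0 (x : B) : GRing.comm 0 x by rewrite /GRing.comm mulr0 mul0r.
  split=> *; rewrite /= /qcomm /serre ?big_ord0
    ?(mulr0, mul0r, mulr1, subrr, scaler0, addr0) //.
rewrite (funext (iter_genS gC)); apply: uq_family_coprod => //.
- apply: IHm => [j|j p x y jp]; first exact: gf.
  by apply: gC; apply: contraNneq jp => /(congr1 val) /= jp; apply/eqP/val_inj.
- move=> x y; have C (j : 'I_m) z z' :
      GRing.comm (g ord_max z) (g (widen_ord (leqnSn m) j) z').
    by apply: gC; rewrite -val_eqE /= gtn_eqF.
  apply: commr_sym; case: x => i /=.
  + apply: commr_sum => j _; apply: commrM => //; exact: commr_prod.
  + apply: commr_sum => j _; apply: commrM => //; exact: commr_prod.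
  + exact: commr_prod.
  + exact: commr_prod.
Qed.

End IteratedCoproduct.

(** * Clifford generators indexed by signed coordinates *)

Section SignedGenerators.
Variables (K : fieldType) (q : K) (p : nat).
Hypotheses (q0 : q != 0) (two0 : 2%:R != 0 :> K).
Local Notation C := (presAlg (@cl_rel K q p)).
Local Notation d := (q - q^-1).

(* The coordinate [(true, k)] stands for -e_k and carries psi_k^dagger. *)
Definition coord := (bool * 'I_p)%type.
Implicit Types u v a b : coord.

Definition opp u : coord := (~~ u.1, u.2).

Definition phi u : C := if u.1 then psid u.2 else psi u.2.

(* The normalization makes [phi_opp] below uniform in the sign of [u]. *)
Definition wt u : C := if u.1 then q^-1 *: omV u.2 else om u.2.

(** The scalar product of two vectors of the form e_k or -e_k. *)
Definition pairing u v : int := (u == v)%:Z - (u == opp v)%:Z.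

Lemma oppK : involutive opp.
Proof. by case=> s k; rewrite /opp /= negbK. Qed.

Lemma eq_oppC u v : (u == opp v) = (opp u == v).
Proof. by apply/eqP/eqP => [->|<-]; rewrite oppK. Qed.

Lemma opp_neq u : (opp u == u) = false.
Proof. by case: u => -[] k; apply/eqP. Qed.

Lemma pairingN u v : pairing u (opp v) = - pairing u v.
Proof. by rewrite /pairing oppK opprB. Qed.

Lemma pairingC u v : pairing u v = pairing v u.
Proof. by rewrite /pairing eq_sym (eq_oppC u) (eq_sym (opp u)). Qed.

Lemma pairingNN u v : pairing (opp u) (opp v) = pairing u v.
Proof. by rewrite pairingN pairingC pairingN opprK pairingC. Qed.

Lemma wt_comm u v : GRing.comm (wt u) (wt v).
Proof.
case: u v => [[] k] [[] l]; rewrite /wt /=.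
- by apply: commZl; apply: commr_sym; apply: commZl; exact: omV_comm.
- by apply: commZl; exact: omV_comm_om.
- by apply: commr_sym; apply: commZl; exact: omV_comm_om.
- exact: om_comm.
Qed.

Lemma wt_opp u : wt u * wt (opp u) = q^-1 *: (1 : C).
Proof.
by case: u => [[] k]; rewrite /wt /= ?pscaleAl ?pscaleAr ?omV_om ?om_omV.
Qed.

Let rel := @cl_rel K q p.
Let pi0 : pres_pi rel 0 = 0. Proof. exact: raddf0. Qed.
Let piD : {morph pres_pi rel : x y / x + y}. Proof. exact: raddfD. Qed.
Let piN : {morph pres_pi rel : x / - x}. Proof. exact: raddfN. Qed.
Let piE := (@pres_piM _ _ rel, piD, piN, @pres_piZ _ _ rel).

Lemma om_psi k l : om k * psi l * omV k = q ^+ (k == l) *: psi l :> C.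
Proof. by rewrite /om /psi /omV !pgenE -!piE; apply/pres_rel/cl_om_psi. Qed.

Lemma om_psid k l : om k * psid l * omV k = q ^- (k == l) *: psid l :> C.
Proof. by rewrite /om /psid /omV !pgenE -!piE; apply/pres_rel/cl_om_psid. Qed.

Lemma psi_psi k l : psi k * psi l + psi l * psi k = 0 :> C.
Proof. by rewrite /psi !pgenE -!piE -pi0; apply/pres_rel/cl_psi_psi. Qed.

Lemma psid_psid k l : psid k * psid l + psid l * psid k = 0 :> C.
Proof. by rewrite /psid !pgenE -!piE -pi0; apply/pres_rel/cl_psid_psid. Qed.

Lemma psi_psid_neq k l : k != l -> psi k * psid l + psid l * psi k = 0 :> C.
Proof.
by move=> kl; rewrite /psi /psid !pgenE -!piE -pi0; apply/pres_rel/cl_psi_psid_neq.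
Qed.

Lemma psi_psid k : psi k * psid k = d^-1 *: (q *: om k - q^-1 *: omV k) :> C.
Proof.
by rewrite /psi /psid /om /omV !pgenE -!piE; apply/pres_rel/cl_psi_psid.
Qed.

Lemma psid_psi k : psid k * psi k = - (d^-1 *: (om k - omV k)) :> C.
Proof.
by rewrite /psi /psid /om /omV !pgenE -!piE; apply/pres_rel/cl_psid_psi.
Qed.

Lemma qcomm_conj c (x xV y : C) : xV * x = 1 -> x * y * xV = c *: y -> qcomm c x y.
Proof. by rewrite /qcomm => xVx xy; rewrite -pscaleAl -xy -[RHS]mulrA xVx mulr1. Qed.

(** It suffices to treat omega_k: up to a scalar, changing the sign of [u] inverts the weight, and
    it negates the pairing. *)
Lemma wt_phi u v : qcomm (q ^ pairing u v) (wt u) (phi v).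
Proof.
have om_phi k : qcomm (q ^ pairing (false, k) v) (om k) (phi v).
  apply: (qcomm_conj (omV_om _ k)); case: v => -[] l.
    by rewrite om_psid /pairing /opp !xpair_eqE /= sub0r -invr_expz.
  by rewrite om_psi /pairing /opp !xpair_eqE /= subr0.
case: u => -[] k; rewrite /wt /=; last exact: om_phi.
apply: qcommZl; rewrite -[(true, k)]/(opp (false, k)) pairingC pairingN pairingC.
rewrite -invr_expz; apply: qcommV; rewrite ?expfz_neq0 //.
- exact: om_omV.
- exact: omV_om.
Qed.

Lemma phi_anti u v : v != opp u -> phi u * phi v = - (phi v * phi u).
Proof.
move=> uv; apply/eqP; rewrite -addr_eq0; apply/eqP; move: uv.
case: u v => [[] k] [[] l]; rewrite /opp /phi xpair_eqE /= => kl.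
- exact: psid_psid.
- by rewrite addrC psi_psid_neq.
- by rewrite psi_psid_neq // eq_sym.
- exact: psi_psi.
Qed.

(** A signed coordinate is never its own opposite, so [phi u] anticommutes with itself; this gives
    twice the square, hence the hypothesis on 2. *)
Lemma phi_sqr u : phi u * phi u = 0.
Proof.
have := @phi_anti u u; rewrite eq_sym opp_neq => /(_ isT) /eqP.
rewrite -addr_eq0 -mulr2n -scaler_nat => /eqP uu.
by rewrite -[LHS]scale1r -(mulVf two0) -scalerA uu scaler0.
Qed.

Lemma phi_opp u : phi u * phi (opp u) = d^-1 *: (q *: wt u - wt (opp u)).
Proof.
case: u => -[] k; rewrite /phi /wt /=; last exact: psi_psid.
by rewrite psid_psi scalerA mulfV // scale1r -scalerN opprB.
Qed.

End SignedGenerators.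

(** * The representation by quadratic elements attached to pairs of coordinates *)

Section PairFamily.
Variables (K : fieldType) (q : K) (p : nat).
Hypotheses (q0 : q != 0) (two0 : 2%:R != 0 :> K).
Local Notation C := (presAlg (@cl_rel K q p)).
Local Notation coord := (coord p).
Local Notation phi := (@phi K q p).
Local Notation wt := (@wt K q p).
Implicit Types a b u v : coord.

(** The scalar product of [a + b] and [u + v]. *)
Definition pairing2 a b u v : int :=
  pairing a u + pairing a v + (pairing b u + pairing b v).

Lemma pairing_id u : pairing u u = 1.
Proof. by rewrite /pairing eqxx eq_sym opp_neq. Qed.

Lemma pairing2NN a b u v :
  pairing2 (opp b) (opp a) (opp v) (opp u) = pairing2 a b u v.
Proof.
rewrite /pairing2 !pairingNN addrC; congr (_ + _); exact: addrC.
Qed.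

Lemma pairing2N a b u v : pairing2 a b (opp v) (opp u) = - pairing2 a b u v.
Proof.
by rewrite /pairing2 !pairingN !opprD; congr (_ + _); apply: addrC.
Qed.

Lemma opp_sym u v : (u == opp v) = (v == opp u).
Proof. by rewrite eq_oppC eq_sym. Qed.

Lemma pairing2C a b u v : pairing2 a b u v = pairing2 u v a b.
Proof.
by rewrite /pairing2 addrACA !(pairingC a) !(pairingC b).
Qed.

(** Anticommutation inside each pair brings the two copies of the shared generator together, and its
    square is zero. *)
Lemma phi2_share a b u v : a != opp b -> u != opp v ->
  [|| a == u, a == v, b == u | b == v] -> phi a * phi b * (phi u * phi v) = 0.
Proof.
move=> ab uv; rewrite !mulrA => /or4P [] /eqP e; rewrite -?e in uv *.
- rewrite -(mulrA (phi a)) (@phi_anti _ _ _ b a) //.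
  by rewrite mulrN !mulrA phi_sqr // !mul0r oppr0 mul0r.
- rewrite -mulrA (@phi_anti _ _ _ u a) 1?opp_sym //.
  rewrite mulrN mulrA -(mulrA (phi a)) (@phi_anti _ _ _ b a) //.
  by rewrite mulrN !mulrA phi_sqr // !mul0r oppr0 mul0r oppr0.
- by rewrite -(mulrA (phi a)) phi_sqr // mulr0 mul0r.
- rewrite -mulrA (@phi_anti _ _ _ u b) 1?opp_sym //.
  by rewrite mulrN mulrA -(mulrA (phi a)) phi_sqr // mulr0 mul0r oppr0.
Qed.

Lemma comm_phi2 a u v : u != opp a -> v != opp a ->
  GRing.comm (phi a) (phi u * phi v).
Proof.
move=> ua va; rewrite /GRing.comm mulrA (@phi_anti _ _ _ a u) // mulNr -[in LHS]mulrA.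
by rewrite (@phi_anti _ _ _ a v) // mulrN opprK mulrA.
Qed.

Lemma phi2_comm a b u v :
  u != opp a -> v != opp a -> u != opp b -> v != opp b ->
  GRing.comm (phi a * phi b) (phi u * phi v).
Proof.
by move=> *; apply: commr_sym; apply: commrM; apply: commr_sym; apply: comm_phi2.
Qed.

(** If a coordinate is shared, both products vanish. Otherwise only coincidences with opposites
    contribute to the pairing, all negatively, so there are none and the generators anticommute. *)
Lemma phi2_comm0 a b u v : a != opp b -> u != opp v ->
  pairing2 a b u v = 0 -> GRing.comm (phi a * phi b) (phi u * phi v).
Proof.
move=> ab uv p0.
have [sh|] := boolP [|| a == u, a == v, b == u | b == v].
  rewrite /GRing.comm !phi2_share //; move: sh.
  by rewrite !(eq_sym a) !(eq_sym b) => /or4P[] ->; rewrite ?orbT.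
rewrite !negb_or => /and4P[au av bu bv]; move: p0.
rewrite /pairing2 /pairing (negPf au) (negPf av) (negPf bu) (negPf bv).
rewrite !(eq_oppC _ u) !(eq_oppC _ v) !(eq_sym _ u) !(eq_sym _ v).
have [ua|ua] := eqVneq u (opp a); have [va|va] := eqVneq v (opp a);
  have [ub|ub] := eqVneq u (opp b); have [vb|vb] := eqVneq v (opp b) => //= _.
exact: phi2_comm.
Qed.

(** Only a shared coordinate contributes positively to the pairing. *)
Lemma phi2_mul0 a b u v : a != opp b -> u != opp v ->
  0 < pairing2 a b u v -> phi a * phi b * (phi u * phi v) = 0.
Proof.
move=> ab uv p0; apply: phi2_share => //; move: p0; rewrite /pairing2 /pairing.
by case: (a == u); case: (a == v); case: (b == u); case: (b == v) => //;
  case: (a == _); case: (a == _); case: (b == _); case: (b == _).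
Qed.

Lemma phi2_sqr a b : a != opp b -> phi a * phi b * (phi a * phi b) = 0.
Proof. by move=> ab; rewrite phi2_share // eqxx. Qed.

(** Squares vanish, so only the middle term is at stake. It is zero as soon as [phi a] or [phi b]
    commutes with [phi u * phi v], because then two copies of that generator meet. *)
Lemma phi2_serre a b u v : a != opp b -> u != opp v -> a != b ->
  pairing2 a b u v = -1 ->
  serre q (phi a * phi b) (phi a * phi b) (phi u * phi v) = 0.
Proof.
move=> ab uv a_b p1; rewrite /serre phi2_sqr // mul0r -(mulrA (phi u * _)) phi2_sqr //.
rewrite mulr0 addr0 sub0r.
suff -> : phi a * phi b * (phi u * phi v) * (phi a * phi b) = 0.
  by rewrite scaler0 oppr0.
set X := phi u * phi v.
have bab : phi b * phi a * phi b = 0.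
  by rewrite (@phi_anti _ _ _ b a) // mulNr -mulrA phi_sqr // mulr0 oppr0.
have aba : phi a * phi b * phi a = 0.
  by rewrite -mulrA (@phi_anti _ _ _ b a) // mulrN mulrA phi_sqr // mul0r oppr0.
have [/andP[ua va]|na] := boolP ((u != opp a) && (v != opp a)).
  have aX : GRing.comm (phi a) X by exact: comm_phi2.
  by rewrite mulrA -(mulrA _ X) -(aX : _ = _) mulrA aba !mul0r.
have [/andP[ub vb]|nb] := boolP ((u != opp b) && (v != opp b)).
  have bX : GRing.comm (phi b) X by exact: comm_phi2.
  by rewrite -(mulrA (phi a)) (bX : _ = _) (mulrA (phi a)) -(mulrA (phi a * X))
    (mulrA (phi b)) bab !mulr0.
have pab : pairing a b = 0.
  by rewrite /pairing (negPf ab) (negPf a_b).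
have ab2 : pairing2 a b a b = 2.
  by rewrite /pairing2 (pairingC b) pab !pairing_id.
(* Now both opposites of [a] and [b] occur among [u], [v]: either one element is both, so [a = b],
   or the pairing is -2 instead of -1. *)
exfalso; case/nandP: na => /negPn/eqP e; case/nandP: nb => /negPn/eqP f.
- by move: a_b; rewrite -(oppK a) -e f oppK eqxx.
- move: p1; rewrite e f /pairing2 !pairingN pab (pairingC b) pab.
  by rewrite !pairing_id.
- move: p1; rewrite e f /pairing2 !pairingN pab (pairingC b) pab.
  by rewrite !pairing_id.
- by move: a_b; rewrite -(oppK a) -e f oppK eqxx.
Qed.

(** Replacing (a, b) by (-b, -a) exchanges E with F and K with its inverse, so each fact about E
    yields one about F. *)
Definition pair_gen r (a b : 'I_r -> coord) (x : uq_gen r) : C :=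
  match x with
  | UE i => phi (a i) * phi (b i)
  | UF i => phi (opp (b i)) * phi (opp (a i))
  | UK i => q *: (wt (a i) * wt (b i))
  | UKV i => q *: (wt (opp (b i)) * wt (opp (a i)))
  end.

Lemma pairK a b : q *: (wt a * wt b) * (q *: (wt (opp b) * wt (opp a))) = 1.
Proof.
rewrite pscaleAl pscaleAr mulrA -(mulrA (wt a)) wt_opp // pscaleAr mulr1.
by rewrite pscaleAl wt_opp // !scalerA mulfK // mulfV // scale1r.
Qed.

Lemma pair_wt_phi a b u v :
  qcomm (q ^ pairing2 a b u v) (q *: (wt a * wt b)) (phi u * phi v).
Proof.
apply: qcommZl; rewrite /pairing2 expfzDr // (expfzDr (pairing a u)) //
  (expfzDr (pairing b u)) //.
by apply: qcommMl; apply: qcommMr; apply: wt_phi.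
Qed.

Lemma wt_phi0 a b : a != b -> a != opp b -> GRing.comm (wt a) (phi b).
Proof.
move=> ab aNb; apply/qcomm1; have := wt_phi q0 a b.
by rewrite /pairing (negPf ab) (negPf aNb).
Qed.

(** The inner product [phi b * phi (opp b)] is a combination of weights that commutes with
    [phi (opp a)]; moving it out leaves [phi a * phi (opp a)]. *)
Lemma phi4_opp a b : a != b -> a != opp b ->
  phi a * phi b * (phi (opp b) * phi (opp a)) =
  (q - q^-1)^-1 ^+ 2 *: ((q *: wt a - wt (opp a)) * (q *: wt b - wt (opp b))).
Proof.
move=> ab aNb; rewrite mulrA -(mulrA (phi a)) phi_opp // pscaleAr pscaleAl.
have wa : GRing.comm (q *: wt b - wt (opp b)) (phi (opp a)).
  have bNa : b != opp a by rewrite opp_sym.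
  apply: commr_sym; apply: commrB; apply: commr_sym.
    by apply: commZl; apply: wt_phi0; rewrite // oppK eq_sym.
  by apply: wt_phi0; rewrite ?oppK 1?eq_sym // (can_eq (@oppK _)).
by rewrite -mulrA (wa : _ = _) mulrA phi_opp // pscaleAl scalerA expr2.
Qed.

Lemma pair_EF_diag a b : a != b -> a != opp b ->
  phi a * phi b * (phi (opp b) * phi (opp a)) -
  phi (opp b) * phi (opp a) * (phi a * phi b) =
  (q - q^-1)^-1 *: (q *: (wt a * wt b) - q *: (wt (opp b) * wt (opp a))).
Proof.
move=> ab aNb; have Nba : opp b != opp a by rewrite (can_eq (@oppK _)) eq_sym.
have NbNNa : opp b != opp (opp a) by rewrite oppK eq_sym.
have := phi4_opp Nba NbNNa; rewrite !oppK => ->.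
rewrite phi4_opp // -scalerBr.
set A := wt a; set A' := wt (opp a); set B := wt b; set B' := wt (opp b).
have wC u v : wt u * wt v = wt v * wt u by exact: wt_comm.
(* The mixed terms [A * B'] and [A' * B] occur in both products with the same coefficient -q and
   cancel. *)
have -> : (q *: A - A') * (q *: B - B') - (q *: B' - B) * (q *: A' - A) =
    (q ^+ 2 - 1) *: (A * B - B' * A').
  rewrite !(mulrBl, mulrBr) !pscaleAl !pscaleAr !scalerA.
  rewrite -expr2 (wC (opp b) a) (wC b (opp a)) (wC b a) (wC (opp a) (opp b)).
  have E (x y z t : C) : x - y - (z - t) = x + t - (y + z).
    by rewrite opprB addrACA opprD.
  rewrite (E (_ *: (A * B))) (E (_ *: (B' * A'))) opprB addrA subrK.
  by rewrite opprD addrACA -scalerBr scalerBl scale1r opprB.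
rewrite -scalerBr !scalerA; congr (_ *: _).
(* When q = q^-1 both scalars are 0, as the inverse of 0 is 0 by convention. *)
have [->|d0] := eqVneq (q - q^-1) 0; first by rewrite invr0 expr2 !mul0r.
have -> : q ^+ 2 - 1 = (q - q^-1) * q by rewrite mulrBl mulVf.
by rewrite expr2 mulrA mulfVK.
Qed.

Lemma uq_family_pair r (c : 'M[int]_r) (a b : 'I_r -> coord) :
  (forall i, a i != b i) -> (forall i, a i != opp (b i)) ->
  (forall i j, c i j = pairing2 (a i) (b i) (a j) (b j)) ->
  (forall i j, i != j -> c i j = 0 \/ c i j = -1) ->
  uq_family q c (pair_gen a b).
Proof.
move=> ab aNb cE c01.
have Nab i : opp (b i) != opp (opp (a i)) by rewrite oppK eq_sym.
split=> /=.
- by move=> i; apply: pairK.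
- by move=> i; rewrite -{2}(oppK (a i)) -{2}(oppK (b i)) pairK.
- move=> i j; apply: commZl; apply: commr_sym; apply: commZl.
  by apply: commMM; apply: wt_comm.
- by move=> i j; rewrite cE; apply: pair_wt_phi.
- by move=> i j; rewrite cE -pairing2N; apply: pair_wt_phi.
- move=> i j; have [<-|ij] := eqVneq i j; first by rewrite mul1r pair_EF_diag.
  rewrite mul0r scale0r.
  (* Passing to the opposite pair negates the Cartan integer: 0 makes E and F commute, and -1
     becomes 1, which kills both products. *)
  have [cij|cij] := c01 i j ij.
    apply/eqP; rewrite subr_eq0; apply/eqP/phi2_comm0 => //.
    by rewrite pairing2N -cE cij oppr0.
  have P : 0 < pairing2 (a i) (b i) (opp (b j)) (opp (a j)).
    by rewrite pairing2N -cE cij.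
  by rewrite !phi2_mul0 ?subr0 // pairing2C.
- by move=> i j _ cij; apply: phi2_comm0; rewrite -?cE.
- by move=> i j _ cij; apply: phi2_comm0; rewrite ?pairing2NN -?cE.
- by move=> i j _ cij; apply: phi2_serre; rewrite -?cE.
- move=> i j _ cij; apply: phi2_serre => //; last by rewrite pairing2NN -cE.
  by rewrite (can_eq (@oppK _)) eq_sym.
Qed.

End PairFamily.

(** * Coordinate pairs of the simple roots of type D *)

Section RootsD.
Variables (n : nat) (hn : (1 < n)%N).

Definition nodeD1 (i : 'I_n) : coord n :=
  (true, if (i.+1 < n)%N then i else ord_penult hn).
(** At the last node [i.+1] is out of range and [insubd] returns its default [ord_last hn], the
    coordinate wanted there. *)
Definition nodeD2 (i : 'I_n) : coord n :=
  (~~ (i.+1 < n)%N, insubd (ord_last hn) i.+1).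

Definition coord_vec (u : coord n) : 'rV[int]_n := (-1) ^+ u.1 *: eps n u.2.

Lemma eps_dot (k l : 'I_n) : (eps n k *m (eps n l)^T) 0 0 = (k == l)%:Z.
Proof.
rewrite mxE (bigD1 k) //= !mxE eqxx mul1r big1 ?addr0 // => i ik.
by rewrite !mxE val_eqE (negPf ik) mul0r.
Qed.

Lemma coord_vec_dot u v : (coord_vec u *m (coord_vec v)^T) 0 0 = pairing u v.
Proof.
rewrite /coord_vec linearZ /= -scalemxAl -scalemxAr scalerA mxE eps_dot.
case: u v => [[] k] [[] l]; rewrite /pairing /opp !xpair_eqE /=;
  by rewrite ?expr1 ?expr0 ?subr0 ?sub0r ?mulrNN ?mulNr ?mulrN ?mul1r.
Qed.

Lemma rootD_coord i : rootD i = - (coord_vec (nodeD1 i) + coord_vec (nodeD2 i)).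
Proof.
rewrite /rootD /coord_vec /= val_insubd; case: ifP => lt_i.
  by rewrite expr1 expr0 scaleN1r scale1r opprD opprK.
by rewrite expr1 !scaleN1r -opprD opprK.
Qed.

Lemma cartanD_pairing i j : cartan (@rootD n) i j =
  pairing2 (nodeD1 i) (nodeD2 i) (nodeD1 j) (nodeD2 j).
Proof.
rewrite mxE !rootD_coord linearN /= mulNmx mulmxN opprK linearD /=.
by rewrite mulmxDl !mulmxDr /pairing2 -!coord_vec_dot !mxE.
Qed.

Lemma nodeD_neq i : nodeD1 i != nodeD2 i.
Proof.
rewrite xpair_eqE -val_eqE /= val_insubd.
case: ifP => //= lt_i; case: i lt_i => i /=; lia.
Qed.

Lemma nodeD_neq_opp i : nodeD1 i != opp (nodeD2 i).
Proof.
rewrite xpair_eqE -val_eqE /= val_insubd.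
by case: ifP => //= lt_i; rewrite ltn_eqF.
Qed.

Lemma cartanD_offdiag i j : i != j ->
  cartan (@rootD n) i j = 0 \/ cartan (@rootD n) i j = -1.
Proof.
rewrite -val_eqE cartanD_pairing /pairing2 /pairing !xpair_eqE /= -!val_eqE /=.
rewrite !val_insubd /=.
case: i j => i hi [] j hj /=.
case: (ltnP i.+1 n) => hi1; case: (ltnP j.+1 n) => hj1 /=; rewrite ?negbK /=.
all: lia.
Qed.

End RootsD.

(** * The commuting blocks and the homomorphism *)

Section BlockHomomorphism.
Variables (K : fieldType) (q : K) (n m : nat) (hn : (1 < n)%N).
Hypotheses (q0 : q != 0) (two0 : 2%:R != 0 :> K).
Local Notation c := (cartan (@rootD n)).

Definition block_coord (j : 'I_m) (u : coord n) : coord (n * m) := (u.1, site u.2 j).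

(** Uniqueness of Euclidean division by [n]. *)
Lemma site_inj (k l : 'I_n) (j j' : 'I_m) :
  (site k j == site l j') = (k == l) && (j == j').
Proof.
apply/eqP/andP => [/(congr1 val) /= e|[/eqP -> /eqP ->]] //.
move: e; rewrite !(addnC (val _)) /= => e; have n0 : (0 < n)%N by exact: ltnW.
have := congr1 (divn^~ n) e; have := congr1 (modn^~ n) e.
rewrite !modnMDl !divnMDl // !modn_small ?divn_small // !addn0.
by move=> /val_inj -> /val_inj ->.
Qed.

Lemma block_coord_eq j u v : (block_coord j u == block_coord j v) = (u == v).
Proof.
by rewrite !xpair_eqE /= site_inj eqxx andbT.
Qed.

Lemma pairing_block j u v :
  pairing (block_coord j u) (block_coord j v) = pairing u v.
Proof.
rewrite /pairing -[opp (block_coord j v)]/(block_coord j (opp v)).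
by rewrite !block_coord_eq.
Qed.

Definition block_gen (j : 'I_m) :=
  pair_gen q (fun i => block_coord j (nodeD1 hn i))
             (fun i => block_coord j (nodeD2 hn i)).

Lemma uq_family_block j : uq_family q c (block_gen j).
Proof.
apply: uq_family_pair => // [i|i|i k|i k].
- by rewrite block_coord_eq nodeD_neq.
- by rewrite -[opp _]/(block_coord j (opp (nodeD2 hn i))) block_coord_eq nodeD_neq_opp.
- by rewrite (cartanD_pairing hn) /pairing2 !pairing_block.
- exact: cartanD_offdiag.
Qed.

(** Coordinates of distinct blocks differ even up to sign. Weights therefore commute with everything
    in the other block, and the generators [phi], which anticommute, enter only in pairs. *)
Lemma block_gen_comm j k x y : j != k ->
  GRing.comm (block_gen j x) (block_gen k y).
Proof.
move=> jk.
have neq u v : block_coord j u != block_coord k v.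
  by rewrite xpair_eqE /= site_inj (negPf jk) !andbF.
have W u v : GRing.comm (wt q (block_coord j u)) (wt q (block_coord k v)).
  exact: wt_comm.
have WF u v : GRing.comm (wt q (block_coord j u)) (phi q (block_coord k v)).
  by apply: wt_phi0 => //; apply: (neq _ (opp v)).
have FW u v : GRing.comm (phi q (block_coord j u)) (wt q (block_coord k v)).
  apply: commr_sym; apply: wt_phi0 => //; first by rewrite eq_sym.
  by rewrite opp_sym; apply: (neq _ (opp v)).
have F a b u v : GRing.comm
    (phi q (block_coord j a) * phi q (block_coord j b))
    (phi q (block_coord k u) * phi q (block_coord k v)).
  by apply: phi2_comm; rewrite opp_sym; apply: (neq _ (opp _)).
have N i u : opp (block_coord i u) = block_coord i (opp u) by [].
case: x => i; case: y => i'; rewrite /block_gen /pair_gen ?N;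
  try apply: commZl; try (apply: commr_sym; apply: commZl; apply: commr_sym);
  by [exact: F | exact: commMM].
Qed.

Definition Lq_gen := iter_gen block_gen.

Lemma Lq_rel x y : uq_rel q c x y -> free_lift Lq_gen x = free_lift Lq_gen y.
Proof.
apply: uq_family_rel; apply: uq_family_iter => //.
- by move=> i j; rewrite !(cartanD_pairing hn) pairing2C.
- move=> i; rewrite (cartanD_pairing hn) /pairing2 (pairingC (nodeD2 hn i)).
  by rewrite /pairing !eqxx (negPf (nodeD_neq hn i)) (negPf (nodeD_neq_opp hn i))
    !(eq_sym _ (opp _)) !opp_neq.
- exact: uq_family_block.
- exact: block_gen_comm.
Qed.

Definition Lq : Uq_so q n -> Cl q (n * m) := pres_lift Lq_rel.
HB.instance Definition _ := GRing.RMorphism.copy Lq (pres_lift Lq_rel).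

Lemma LqZ : scalable Lq.
Proof. exact: pres_liftZ. Qed.

(** Taking the restriction of [Lq] is legitimate, since [is_lambda_unique] shows that the formulas
    determine lambda_q. *)
Definition lambdaq : {rmorphism Uq_sl q n -> Cl q (n * m)} := Lq \o @sl_incl K q n.

Lemma lambdaqZ : scalable lambdaq.
Proof. by move=> k x; rewrite /= sl_inclZ LqZ. Qed.

End BlockHomomorphism.

(** * Matching the values at generators with the stated formulas *)

Section Formulas.
Variables (K : fieldType) (q : K) (n m : nat) (hn : (1 < n)%N).
Hypotheses (q0 : q != 0) (two0 : 2%:R != 0 :> K).
Local Notation Lq := (@Lq K q n m hn q0 two0).

Lemma nodeD1_nodeA i : nodeD1 hn (nodeA i) = (true, nodeA i).
Proof. by rewrite /nodeD1 /= nodeA_next_subproof. Qed.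

Lemma nodeD2_nodeA i : nodeD2 hn (nodeA i) = (false, nodeA_next i).
Proof.
rewrite /nodeD2 /= nodeA_next_subproof; congr (_, _); apply: val_inj.
by rewrite val_insubd /= nodeA_next_subproof.
Qed.

Lemma nodeD1_last : nodeD1 hn (ord_last hn) = (true, ord_penult hn).
Proof. by rewrite /nodeD1 /= prednK ?ltnn // ltnW. Qed.

Lemma nodeD2_last : nodeD2 hn (ord_last hn) = (true, ord_last hn).
Proof.
rewrite /nodeD2 /= prednK ?ltnn 1?ltnW //; congr (_, _); apply: val_inj.
by rewrite val_insubd /= ltnn.
Qed.

Lemma block_K_nodeA i (p : 'I_m) : block_gen q hn p (UK (nodeA i)) = kfac q i p.
Proof.
rewrite /block_gen /pair_gen nodeD1_nodeA nodeD2_nodeA /wt /=.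
by rewrite pscaleAl scalerA mulfV // scale1r.
Qed.

Lemma block_KV_nodeA i (p : 'I_m) : block_gen q hn p (UKV (nodeA i)) = kfacV q i p.
Proof.
rewrite /block_gen /pair_gen nodeD1_nodeA nodeD2_nodeA /wt /=.
by rewrite pscaleAl scalerA mulfV // scale1r.
Qed.

(** Both coordinates are negative here, so two factors q^-1 meet one factor q; at the other nodes
    the powers of q cancel. *)
Lemma block_K_last (p : 'I_m) : block_gen q hn p (UK (ord_last hn)) =
  kappa_fac q hn p :> Cl q (n * m).
Proof.
rewrite /block_gen /pair_gen nodeD1_last nodeD2_last /wt /=.
by rewrite pscaleAl pscaleAr !scalerA mulfV // mul1r.
Qed.

Lemma block_KV_last (p : 'I_m) : block_gen q hn p (UKV (ord_last hn)) =
  kappa_facV q hn p :> Cl q (n * m).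
Proof.
rewrite /block_gen /pair_gen nodeD1_last nodeD2_last /wt /=.
by congr (_ *: _); apply: om_comm.
Qed.

Lemma LqE x : Lq (pgen _ x) = Lq_gen q m hn x.
Proof. exact: pres_lift_gen. Qed.

Lemma lambdaq_is_lambda : is_lambda (lambdaq m hn q0 two0).
Proof.
move=> i; rewrite /= /sl_incl !pres_lift_gen /=.
split; rewrite LqE /=.
- apply: eq_bigr => j _.
  by congr (_ * _);
    [rewrite nodeD1_nodeA nodeD2_nodeA
    |apply: eq_bigr => p _; apply: block_K_nodeA].
- apply: eq_bigr => j _.
  rewrite -[RHS]mulrA.
  by congr (_ * _);
    [apply: eq_bigr => p _; apply: block_KV_nodeA
    |rewrite nodeD1_nodeA nodeD2_nodeA].
- by apply: eq_bigr => p _; apply: block_K_nodeA.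
Qed.

Lemma Lq_E_last : Lq (uE (ord_last hn)) =
  \sum_(j < m) psid (site (ord_penult hn) j) * psid (site (ord_last hn) j)
                 * kappa_lt q m hn j.
Proof.
rewrite LqE /=; apply: eq_bigr => j _.
by congr (_ * _);
  [rewrite nodeD1_last nodeD2_last
  |apply: eq_bigr => p _; apply: block_K_last].
Qed.

Lemma Lq_F_last : Lq (uF (ord_last hn)) =
  \sum_(j < m) kappa_gtV q m hn j * psi (site (ord_last hn) j)
                 * psi (site (ord_penult hn) j).
Proof.
rewrite LqE /=; apply: eq_bigr => j _; rewrite -[RHS]mulrA.
by congr (_ * _);
  [apply: eq_bigr => p _; apply: block_KV_last
  |rewrite nodeD1_last nodeD2_last].
Qed.

Lemma Lq_K_last : Lq (uK (ord_last hn)) = kappa_lt q m hn m.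
Proof.
rewrite LqE /=; apply: eq_big => [p|p _]; first by rewrite ltn_ord.
exact: block_K_last.
Qed.

End Formulas.

(** * Specialization to the base field of rational functions *)

Lemma qvar_neq0 (R : realType) : qvar R != 0.
Proof. by rewrite /qvar tofrac_eq0 polyX_eq0. Qed.

Lemma Cq_two_neq0 (R : realType) : 2%:R != 0 :> Cq R.
Proof.
rewrite -(rmorph_nat (@tofrac {poly R[i]})) tofrac_eq0.
by rewrite -polyC_natr polyC_eq0 Num.Theory.pnatr_eq0.
Qed.

Theorem mainTheorem3 (R : realType) (n m : nat) (hn : (1 < n)%N) (hm : (0 < m)%N) :
  exists lambda : {rmorphism Uq_sl (qvar R) n -> Cl (qvar R) (n * m)},
    [/\ scalable lambda, is_lambda lambda &
    exists L : {rmorphism Uq_so (qvar R) n -> Cl (qvar R) (n * m)},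
      [/\ scalable L,
          L (uE (ord_last hn)) =
            \sum_(j < m) psid (site (ord_penult hn) j)
                           * psid (site (ord_last hn) j) * kappa_lt _ m hn j,
          L (uF (ord_last hn)) =
            \sum_(j < m) kappa_gtV _ m hn j * psi (site (ord_last hn) j)
                           * psi (site (ord_penult hn) j),
          L (uK (ord_last hn)) = kappa_lt _ m hn m
        & forall X : Uq_sl (qvar R) n, L (sl_incl X) = lambda X]].
Proof.
exists (lambdaq m hn (qvar_neq0 R) (Cq_two_neq0 R)); split.
- exact: lambdaqZ.
- exact: lambdaq_is_lambda.
(* Compatibility with lambda_q holds by definition, lambda_q being the composite of this map with
   [sl_incl]. *)
exists (Lq m hn (qvar_neq0 R) (Cq_two_neq0 R)); split=> //.
- exact: LqZ.
- exact: Lq_E_last.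
- exact: Lq_F_last.
- exact: Lq_K_last.
Qed.
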